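(* Let $k$ be a field of characteristic zero and $G$ a finite group. Let $I(G)$ be the two-sided ideal of $kB(G,G)$ spanned by the $(G,G)$-bisets $(G\times G)/(A\times B)$ for $A,B\le G$ (equivalently, generated by all $(G,G)$-bisets that factor through the trivial group), and let $I_c(G)$ be the $k$-subspace of $I(G)$ spanned by the elements $(G\times G)/(A\times B)$ with $A$ and $B$ cyclic subgroups of $G$. Let $M$ be the kernel of the action of $kB(G,G)$ on the simple module $S_{1,k}(G)$ (a maximal two-sided ideal). Then: (1) $kB(G,G)=I_c(G)\oplus M$; (2) $I(G)=I_c(G)\oplus\big(I(G)\cap J(kB(G,G))\big)$; (3) $\dim\big(I(G)\cap J(kB(G,G))\big)=b(G)^2-c(G)^2$, where $b(G)$ is the number of conjugacy classes of subgroups of $G$ and $c(G)$ the number of conjugacy classes of cyclic subgroups of $G$.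
   Context: $(G,H)$-bisets are finite sets with commuting left $G$- and right $H$-actions; $kB(G,H)=k\otimes_{\mathbb Z}B(G,H)$ with $B(G,H)$ the Grothendieck group; composition $U\times_HV=(U\times V)/((uh,v)\sim(u,hv))$; $kB(G,G)$ is the double Burnside algebra; $(G\times G)/(A\times B)$ denotes the $(G,G)$-biset $G\times G$ modulo $A\times B$, with $(G,G)$-action $g\cdot(x,y)\cdot g'=(gx,g'^{-1}y)$. Biset functors are $k$-linear functors from the category of finite groups with $\mathrm{Hom}(H,G)=kB(G,H)$ to $k$-vector spaces. For the trivial group $1$ and trivial module $k$: $L_{1,k}=kB(-,1)\otimes_k k$, $J_{1,k}(X)=\{x\in L_{1,k}(X):\psi\cdot x=0\ \forall\psi\in kB(1,X)\}$, $S_{1,k}=L_{1,k}/J_{1,k}$, a simple biset functor; $S_{1,k}(G)$ is a simple $kB(G,G)$-module (isomorphic to $k\otimes R_{\mathbb Q}(G)$, of dimension $c(G)$). $J(\cdot)$ denotes Jacobson radical. *)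

(* Defs.v *)
(* Model of the double Burnside algebra kB(G,G) and of the
   bimodules kB(X,Y) for subgroups X, Y of a finite group gT (the trivial
   group 1 is realised as the subgroup [1 gT]). *)
From HB Require Import structures.
From mathcomp Require Import all_boot all_order all_algebra all_fingroup all_solvable.
Set Implicit Arguments. Unset Strict Implicit. Unset Printing Implicit Defensive.
Import GRing.Theory.
Local Open Scope ring_scope.

Section Bisets.
Variables (k : fieldType) (gT : finGroupType).

Local Notation pT := (gT * gT)%type.
(* Index set of coordinates: sets of subsets of X x Y; only the conjugacy
   classes  L :^: (X x Y)  of subgroups L of X x Y carry coefficients. *)
Definition cls_index := {set {set pT}}.
(* Ambient k-vector space containing every kB(X,Y). *)
Definition Bvec := {ffun cls_index -> k^o}.

Definition bcls (X Y : {set gT}) (L : {set pT}) : cls_index :=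
  (L :^: setX X Y)%g.

(* [ (X x Y)/L ] : the basis element attached to L <= X x Y.
   As an (X,Y)-biset, (X x Y)/L has action x.(a,b)L.y = (x a, y^-1 b)L. *)
Definition eB (X Y : {set gT}) (L : {set pT}) : Bvec :=
  [ffun C => (C == bcls X Y L)%:R].

Definition kB (X Y : {group gT}) : {vspace Bvec} :=
  (\sum_(L : {group pT} | L \subset setX X Y) <[eB X Y L]>)%VS.

Definition bset (X Y : {set gT}) (L : {set pT}) : {set {set pT}} :=
  lcosets L (setX X Y).

(* U x_Y V: the equivalence classes of (u h, v) ~ (u, h v), for
   U = (X x Y)/L and V = (Y x Z)/M.  The class of (C,D) is
   {(C.h, h^-1.D) | h in Y} = {((1,h)C, (h,1)D) | h in Y}. *)
Definition tensor_set (X Y Z : {set gT}) (L M : {set pT})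
  : {set {set ({set pT} * {set pT})}} :=
  [set [set (lcoset C ((1%g, h) : pT), lcoset D ((h, 1%g) : pT)) | h in Y]
     | C in bset X Y L, D in bset Y Z M].

(* (X x Z)-action on U x_Y V corresponding to the biset structure:
   (x,z).[C,D] = x.[C,D].z^-1 = [(x,1)C, (1,z)D]. *)
Definition tensor_act (p : pT) (w : {set ({set pT} * {set pT})}) :=
  [set (lcoset cd.1 ((p.1, 1%g) : pT), lcoset cd.2 ((1%g, p.2) : pT)) | cd in w].

Definition tensor_stab (X Z : {set gT}) w :=
  [set p in setX X Z | tensor_act p w == w].

Definition tensor_orbit (X Z : {set gT}) w :=
  [set tensor_act p w | p in setX X Z].

(* [ (X x Y)/L  x_Y  (Y x Z)/M ] in kB(X,Z): sum over the (X x Z)-orbits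
   of U x_Y V of the class of a point stabiliser (each orbit O is counted
   as  sum_{w in O} 1/|O| ). *)
Definition bcomp (X Y Z : {set gT}) (L M : {set pT}) : Bvec :=
  \sum_(w in tensor_set X Y Z L M)
     (#|tensor_orbit X Z w|%:R)^-1 *: eB X Z (tensor_stab X Z w).

Definition pick_cls (C : cls_index) : {set pT} := odflt set0 [pick L in C].

Definition bmul (X Y Z : {set gT}) (x y : Bvec) : Bvec :=
  \sum_(C : cls_index) \sum_(D : cls_index)
     (x C * y D) *: bcomp X Y Z (pick_cls C) (pick_cls D).

Definition left_ideal (G : {group gT}) (U : {vspace Bvec}) : Prop :=
  (U <= kB G G)%VS /\
  forall x u, x \in kB G G -> u \in U -> bmul G G G x u \in U.

Definition max_left_ideal (G : {group gT}) (U : {vspace Bvec}) : Prop :=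
  left_ideal G U /\ U != kB G G /\
  forall U' : {vspace Bvec}, left_ideal G U' -> (U <= U')%VS ->
     U' = U \/ U' = kB G G.

Definition jacobson (G : {group gT}) (a : Bvec) : Prop :=
  a \in kB G G /\ forall U, max_left_ideal G U -> a \in U.

Definition IG (G : {group gT}) : {vspace Bvec} :=
  (\sum_(A : {group gT} | A \subset G) \sum_(B : {group gT} | B \subset G)
     <[eB G G (setX A B)]>)%VS.

Definition IcG (G : {group gT}) : {vspace Bvec} :=
  (\sum_(A : {group gT} | (A \subset G) && cyclic A)
     \sum_(B : {group gT} | (B \subset G) && cyclic B)
     <[eB G G (setX A B)]>)%VS.

Definition one_grp : {group gT} := [1 gT]%G.

Definition J1k (G : {group gT}) (x : Bvec) : Prop :=
  x \in kB G one_grp /\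
  forall psi, psi \in kB one_grp G -> bmul one_grp G one_grp psi x = 0.

(* Kernel of the action of kB(G,G) on S_{1,k}(G) = L_{1,k}(G)/J_{1,k}(G). *)
Definition annS1k (G : {group gT}) (a : Bvec) : Prop :=
  a \in kB G G /\
  forall x, x \in kB G one_grp -> J1k G (bmul G G one_grp a x).

Definition direct_sum (A P Q : Bvec -> Prop) : Prop :=
  (forall v, A v <-> exists p q, P p /\ Q q /\ v = p + q) /\
  (forall v, P v -> Q v -> v = 0).

End Bisets.

Definition nb_cls_sub (gT : finGroupType) (G : {group gT}) : nat :=
  #|[set (H :^: G)%g | H : {group gT} in subgroups G]|.
Definition nb_cls_cyc (gT : finGroupType) (G : {group gT}) : nat :=
  #|[set (H :^: G)%g | H : {group gT} in [set H in subgroups G | cyclic H]]|.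

(* Main.v *)
Require Import Defs.
From HB Require Import structures.
From mathcomp Require Import all_boot all_order all_algebra all_fingroup all_solvable ring.
Set Implicit Arguments. Unset Strict Implicit. Unset Printing Implicit Defensive.
Import GRing.Theory.
Local Open Scope ring_scope.

(** The fixed-point character [chi x] of [x] in kB(X,Y) turns the composition of
    bisets into a convolution: chi(x y)(g,z) = |Y|^-1 sum_h chi x (g,h) chi y (h,z).
    Writing theta_B for the permutation character of G/B, an element a of kB(G,G)
    kills S_{1,k}(G) iff sum_{g,h} theta_B(g) chi a (g,h) theta_C(h) = 0 for all
    B, C <= G.  By Artin's induction theorem the theta_B with B cyclic form a basis
    of the functions constant on the classes {g | <g> conjugate to a given cyclic
    group}; averaging chi a over products of two such classes therefore gives the
    unique element of I_c(G) congruent to a modulo M.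
    For x in kB(G,1), the elements u with u x in J_{1,k} form a left ideal that is
    maximal if it is proper, so the Jacobson radical lies in M.  Conversely, the product
    e_{A,B} a e_{C,D} in I(G) is a multiple of
    sum_{g,h} theta_B(g) chi a (g,h) theta_C(h), so I(G) meets M in a left ideal
    of cube zero, which lies in the radical. *)

(** * Counting along fibres and cosets *)

Section Counting.
Local Open Scope group_scope.

Lemma card_imset_fibers (T U : finType) (A : {set T}) (f : T -> U) n :
  {in A, forall x, #|[set y in A | f y == f x]| = n} ->
  (#|f @: A| * n)%N = #|A|.
Proof.
move=> fibn; rewrite -[RHS]sum1_card (partition_big_imset f) /=.
rewrite -sum_nat_const; apply: eq_bigr => _ /imsetP[x xA ->].
by rewrite -(fibn x xA) -sum1dep_card.
Qed.

(** Orbit-stabiliser for a map known only through its fibres, which are left cosets of [K] in [H].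
    [K] is a plain set so that the count also applies to [midker], which carries no group
    structure. *)
Lemma card_imset_cosets (T : finGroupType) (U : finType) (H : {group T})
    (K : {set T}) (f : T -> U) :
  K \subset H ->
  {in H &, forall x y, (f x == f y) = (x^-1 * y \in K)} ->
  (#|f @: H| * #|K|)%N = #|H|.
Proof.
move=> sKH fP; apply: card_imset_fibers => x xH.
rewrite -(card_lcoset K x); apply: eq_card => y.
rewrite mem_lcoset !inE; case: (boolP (y \in H)) => [yH | yH] /=.
  by rewrite eq_sym fP.
apply/esym/negbTE; apply: contra yH => /(subsetP sKH).
by rewrite groupMl ?groupV.
Qed.

Lemma lcoset_transl_eq (T : finGroupType) (L : {group T}) (a b p : T) :
  (a *: (p *: L) == b *: (p *: L)) = (b^-1 * a \in L :^ p^-1).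
Proof.
rewrite -!lcosetM mem_conjgV conjgE.
have -> : p^-1 * (b^-1 * a * p) = (b * p)^-1 * (a * p) by rewrite invMg !mulgA.
by rewrite -mem_lcoset; apply: (sameP eqP lcoset_eqP).
Qed.

Lemma lcoset_transl2_eq (T : finGroupType) (L : {group T}) (a b c p : T) :
  (a *: (p *: L) == b *: (c *: (p *: L))) = ((b * c)^-1 * a \in L :^ p^-1).
Proof. by rewrite -[b *: _]lcosetM lcoset_transl_eq. Qed.

Lemma setX_conj (gT : finGroupType) (A B : {set gT}) (r : gT * gT) :
  setX A B :^ r = setX (A :^ r.1) (B :^ r.2).
Proof.
by apply/setP=> -[x y]; rewrite mem_conjg !inE !mem_conjg.
Qed.

End Counting.

(** * Stabilisers, orbits and classes in the composition of two transitive bisets *)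

Section StarProduct.
Variable gT : finGroupType.
Local Notation pT := (gT * gT)%type.
Local Open Scope group_scope.
Implicit Types (L M : {group pT}) (X Y Z : {group gT}).

(** Composition of [L] and [M] as relations: Bouc's product of subgroups, which gives the point
    stabilisers in a composed biset. *)
Definition star (L M : {set pT}) : {set pT} :=
  [set s | [exists h, ((s.1, h) \in L) && ((h, s.2) \in M)]].

(** The ambiguity of the middle element: the fibres of the composition [star L M] are cosets of
    it. *)
Definition midker (L M : {set pT}) : {set gT} :=
  [set h | ((1, h) \in L) && ((h, 1) \in M)].

Lemma star_group_set L M : group_set (star L M).
Proof.
apply/group_setP; split; first by rewrite inE; apply/existsP; exists 1; rewrite !group1.
move=> [x z] [x' z']; rewrite !inE => /existsP[h /andP[h1 h2]] /existsP[h' /andP[h1' h2']].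
apply/existsP; exists (h * h'); apply/andP; split.
  exact: (groupM h1 h1').
exact: (groupM h2 h2').
Qed.
Canonical star_group L M := Group (star_group_set L M).

Lemma star_sub X Y Z L M :
  L \subset setX X Y -> M \subset setX Y Z -> star L M \subset setX X Z.
Proof.
move=> sL sM; apply/subsetP => -[x z]; rewrite !inE => /existsP[h /andP[]].
by move/(subsetP sL); rewrite inE /= => /andP[-> _]; move/(subsetP sM); rewrite inE => /andP[].
Qed.

(** Two middle elements joining [x] to [z] differ by an element of [midker]. This count is what
    later turns the Mackey formula into a convolution. *)
Lemma card_star_fiber L M x z :
  #|[set h | ((x, h) \in L) && ((h, z) \in M)]|
    = (((x, z) \in star L M) * #|midker L M|)%N.
Proof.
rewrite [in RHS]inE; case: existsP => [[h /andP[/= h1 h2]] | no] /=; last first.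
  apply/eqP; rewrite cards_eq0; apply/eqP/setP=> h; rewrite !inE.
  by apply/negP => hh; apply: no; exists h.
rewrite mul1n -(card_lcoset (midker L M) h); apply: eq_card => h'.
rewrite mem_lcoset !inE.
have -> : (1, h^-1 * h') = (x, h)^-1 * (x, h') :> pT by congr (_, _); rewrite mulVg.
have -> : (h^-1 * h', 1) = (h, z)^-1 * (h', z) :> pT by congr (_, _); rewrite mulVg.
by rewrite !groupMl ?groupV.
Qed.

Lemma star_conj L M (r : pT) :
  star L M :^ r = star (L :^ (r.1, 1)) (M :^ (1, r.2)).
Proof.
apply/setP => -[x z]; rewrite mem_conjg !inE; apply: eq_existsb => h.
by rewrite !mem_conjg; congr (_ && _); congr (in_mem _ _); congr (_, _);
  rewrite /= ?invg1 ?mul1g ?mulg1.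
Qed.

Lemma midker_conj L M (r : pT) :
  midker (L :^ (r.1, 1)) (M :^ (1, r.2)) = midker L M.
Proof.
apply/setP => h; rewrite !inE !mem_conjg.
by congr (_ && _); congr (in_mem _ _); congr (_, _); rewrite /= ?invg1 ?mul1g ?mulg1 ?mulVg.
Qed.

Definition tensor_class (Y : {set gT}) (C D : {set pT}) :
    {set {set pT} * {set pT}} :=
  [set (lcoset C ((1%g, h) : pT), lcoset D ((h, 1%g) : pT)) | h in Y].

Lemma mem_tensor_class Y C D : (C, D) \in tensor_class Y C D.
Proof. by apply/imsetP; exists 1; rewrite ?group1 // !lcosetE !lcoset1. Qed.

Lemma tensor_class_transl Y C D h : h \in Y ->
  tensor_class Y (lcoset C ((1, h) : pT)) (lcoset D ((h, 1) : pT))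
    = tensor_class Y C D.
Proof.
move=> hY; apply/setP=> w; apply/imsetP/imsetP => -[h' h'Y ->].
  exists (h' * h); rewrite ?groupM // !lcosetE -!lcosetM.
  by congr (_ *: _, _ *: _); congr (_, _); rewrite /= ?mulg1.
exists (h' * h^-1); rewrite ?groupM ?groupV // !lcosetE -!lcosetM.
by congr (_ *: _, _ *: _); congr (_, _); rewrite /= ?mulg1 ?mulgKV.
Qed.

Lemma tensor_class_eq Y C D C' D' :
  (tensor_class Y C' D' == tensor_class Y C D) = ((C', D') \in tensor_class Y C D).
Proof.
apply/eqP/idP => [<- | /imsetP[h hY [-> ->]]]; first exact: mem_tensor_class.
exact: tensor_class_transl.
Qed.

Lemma tensor_act_class Y C D s :
  tensor_act s (tensor_class Y C D)
    = tensor_class Y (lcoset C ((s.1, 1) : pT)) (lcoset D ((1, s.2) : pT)).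
Proof.
rewrite /tensor_act /tensor_class -imset_comp; apply: eq_imset => h /=.
rewrite !lcosetE -!lcosetM.
by congr (_ *: _, _ *: _); congr (_, _); rewrite /= ?mulg1 ?mul1g.
Qed.

Section Class.
Variables (X Y Z : {group gT}) (L M : {group pT}).
Hypotheses (sL : L \subset setX X Y) (sM : M \subset setX Y Z).
Variables (p q : pT).
Hypotheses (pXY : p \in setX X Y) (qYZ : q \in setX Y Z).

Let Lp := (L :^ p^-1)%G.
Let Mq := (M :^ q^-1)%G.
Let sLp : Lp \subset setX X Y.
Proof. by rewrite -(conjGid (groupVr pXY)) conjSg. Qed.
Let sMq : Mq \subset setX Y Z.
Proof. by rewrite -(conjGid (groupVr qYZ)) conjSg. Qed.
Local Notation w := (tensor_class Y (p *: L) (q *: M)).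

(** The cosets [p *: L] and [q *: M] have stabilisers [Lp] and [Mq]. An [h] in [Y] relating the two
    translated representatives has as its inverse the middle element required by [star Lp Mq]. *)
Lemma tensor_act_eq s s' : s \in setX X Z -> s' \in setX X Z ->
  (tensor_act s w == tensor_act s' w) = (s^-1 * s' \in star Lp Mq).
Proof.
move: s s' => [x z] [x' z'] _ _; rewrite !tensor_act_class eq_sym tensor_class_eq.
rewrite [in RHS]inE /=; apply/imsetP/existsP => [[h hY [e1 e2]] | [h /andP[h1 h2]]].
  exists h^-1; apply/andP; split.
    move/eqP: e1; rewrite !lcosetE lcoset_transl2_eq.
    by congr (is_true (in_mem _ _)); congr (_, _) => /=; rewrite ?invg1 ?mulg1 ?mul1g.
  move/eqP: e2; rewrite !lcosetE lcoset_transl2_eq.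
  by congr (is_true (in_mem _ _)); congr (_, _) => /=; rewrite ?invg1 ?mulg1 ?mul1g.
have hY : h \in Y by have:= subsetP sLp _ h1; rewrite inE => /andP[].
exists h^-1; rewrite ?groupV // !lcosetE; congr (_, _); apply/eqP; rewrite lcoset_transl2_eq.
  by move: h1; congr (is_true (in_mem _ _)); congr (_, _) => /=; rewrite ?invg1 ?mulg1 ?mul1g ?invgK.
by move: h2; congr (is_true (in_mem _ _)); congr (_, _) => /=; rewrite ?invg1 ?mulg1 ?mul1g ?invgK.
Qed.

Lemma tensor_stabE : tensor_stab X Z w = star Lp Mq.
Proof.
have act1 : tensor_act 1 w = w by rewrite tensor_act_class !lcosetE !lcoset1.
apply/setP=> s; rewrite in_set; case: (boolP (s \in setX X Z)) => [sXZ | nsXZ] /=.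
  by rewrite eq_sym -{1}act1 tensor_act_eq ?group1 // invg1 mul1g.
by apply/esym/negbTE; apply: contra nsXZ; apply/subsetP/(star_sub sLp sMq).
Qed.

Lemma card_tensor_orbit :
  (#|tensor_orbit X Z w| * #|star Lp Mq|)%N = (#|X| * #|Z|)%N.
Proof.
rewrite -[RHS]cardsX; apply: (@card_imset_cosets _ _ (setX_group X Z)); first exact: star_sub sLp sMq.
by move=> s s' sXZ s'XZ; apply: tensor_act_eq.
Qed.

Lemma card_tensor_class : (#|w| * #|midker Lp Mq|)%N = #|Y|.
Proof.
rewrite /tensor_class; apply: card_imset_cosets => [|h h' hY h'Y].
  by apply/subsetP => h; rewrite inE => /andP[/(subsetP sLp)]; rewrite inE => /andP[].
rewrite eq_sym xpair_eqE !lcosetE !lcoset_transl_eq inE.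
by congr (_ && _); congr (in_mem _ _); congr (_, _); rewrite /= ?invg1 ?mulg1.
Qed.

End Class.

(** The pairs [(p, q)] over [w] map onto the pairs of cosets that make up [w], and each pair of
    cosets has $|L||M|$ pairs of representatives. *)
Lemma card_tensor_fiber X Y Z L M w :
  L \subset setX X Y -> M \subset setX Y Z -> w \in tensor_set X Y Z L M ->
  #|[set pq in setX (setX X Y) (setX Y Z) |
       tensor_class Y (pq.1 *: L) (pq.2 *: M) == w]|
    = (#|w| * (#|L| * #|M|))%N.
Proof.
move=> sL sM /imset2P[_ _ /imsetP[p pXY ->] /imsetP[q qYZ ->] ->] {w}.
rewrite -/(tensor_class Y _ _) !lcosetE; set w := tensor_class _ _ _.
set A := [set _ in _ | _].
pose f (pq : pT * pT) := (pq.1 *: L, pq.2 *: M).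
have AP pq : (pq \in A) = [&& pq.1 \in setX X Y, pq.2 \in setX Y Z & f pq \in w].
  by case: pq => a b; rewrite in_set in_setX tensor_class_eq -andbA.
have <- : f @: A = w.
  apply/setP=> cd; apply/imsetP/idP => [[pq] | cdw].
    by rewrite AP => /and3P[_ _ ?] ->.
  have /imsetP[h hY] := cdw; rewrite !lcosetE -!lcosetM => cdE.
  exists ((1, h) * p, (h, 1) * q); last by [].
  rewrite AP /f /= -cdE cdw andbT.
  by apply/andP; split; rewrite groupM // inE /= ?group1 ?hY.
apply/esym/card_imset_fibers => -[a b]; rewrite AP => /and3P[/= aXY bYZ abw].
rewrite -(card_lcoset L a) -(card_lcoset M b) -cardsX; apply: eq_card => -[c d].
rewrite in_setX /= in_set AP /f /= xpair_eqE.
apply/andP/andP => [[_ /andP[/eqP<- /eqP<-]] | [cL dM]]; first by rewrite !lcoset_refl.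
have eL : c *: L = a *: L by apply/lcoset_eqP.
have eM : d *: M = b *: M by apply/lcoset_eqP.
split; last by rewrite eL eM !eqxx.
rewrite eL eM [_ \in w]abw andbT; apply/andP; split.
  by case/lcosetP: cL => l /(subsetP sL) lXY ->; rewrite groupM.
by case/lcosetP: dM => l /(subsetP sM) lXY ->; rewrite groupM.
Qed.

End StarProduct.

(** * The Mackey formula in averaged form *)

Section Formula.
Variables (k : fieldType) (gT : finGroupType).
Local Notation pT := (gT * gT)%type.
Implicit Types (L M : {group pT}) (X Y Z : {group gT}).
Hypothesis char0 : [pchar k] =i pred0.

Lemma natr_card_neq0 (T : finGroupType) (H : {group T}) : #|H|%:R != 0 :> k.
Proof. by rewrite (proj1 (pcharf0P k)) // -lt0n cardG_gt0. Qed.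

(** The Mackey formula, averaged over all pairs of coset representatives instead of summed over
    double cosets, so that no choice of representatives enters. The cardinals of a class and of its
    orbit are replaced by $|Y|/|midker|$ and $|X||Z|/|star|$. *)
Lemma bcompE X Y Z L M : L \subset setX X Y -> M \subset setX Y Z ->
  bcomp k X Y Z L M =
  (#|X| * #|Y| * #|Z| * (#|L| * #|M|))%:R^-1 *:
    \sum_(p in setX X Y) \sum_(q in setX Y Z)
      (#|midker (L :^ p)%g (M :^ q)%g| * #|star (L :^ p)%g (M :^ q)%g|)%:R
         *: eB k X Z (star (L :^ p)%g (M :^ q)%g).
Proof.
move=> sL sM.
(* Dividing by the size of [w] compensates for the number of pairs of cosets that represent [w]. *)
pose F (w : {set {set pT} * {set pT}}) :=
  (#|w|%:R)^-1 *: ((#|tensor_orbit X Z w|%:R)^-1 *: eB k X Z (tensor_stab X Z w)).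
have nz w : w \in tensor_set X Y Z L M -> #|w|%:R != 0 :> k.
  case/imset2P=> C D _ _ ->; rewrite (proj1 (pcharf0P k)) // cards_eq0.
  by apply/set0Pn; exists (C, D); apply: mem_tensor_class.
pose c (pq : pT * pT) := tensor_class Y (pq.1 *: L)%g (pq.2 *: M)%g.
have -> : bcomp k X Y Z L M = (#|L| * #|M|)%:R^-1 *:
    \sum_(pq in setX (setX X Y) (setX Y Z)) F (c pq).
  have imc : c @: setX (setX X Y) (setX Y Z) = tensor_set X Y Z L M.
    apply/setP=> w; apply/imsetP/imset2P => [[[p q]] | [_ _ /imsetP[p pXY ->] /imsetP[q qYZ ->] ->]].
      rewrite in_setX => /andP[pXY qYZ] ->.
      by exists (lcoset L p) (lcoset M q); rewrite ?imset_f // !lcosetE.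
    by exists (p, q); rewrite ?in_setX ?pXY // /c !lcosetE.
  rewrite (partition_big_imset c) imc scaler_sumr; apply: eq_bigr => w wT.
  rewrite (eq_bigr (fun=> F w)); last by move=> pq /andP[_ /eqP->].
  rewrite sumr_const.
  have -> : #|[pred i in setX (setX X Y) (setX Y Z) | c i == w]| = (#|w| * (#|L| * #|M|))%N.
    by rewrite -(card_tensor_fiber sL sM wT); apply: eq_card => pq; rewrite !inE.
  rewrite -scaler_nat /F [in RHS]scalerA [in RHS]scalerA -[LHS]scale1r.
  by congr (_ *: _); rewrite !natrM; field; rewrite nz ?natr_card_neq0.
rewrite [in RHS]natrM invfM mulrC -[RHS]scalerA; congr (_ *: _).
(* The stabilisers of the cosets are conjugates by the inverses of [p] and [q]; the sum is reindexed
   by inversion to remove them. *)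
rewrite pair_big scaler_sumr (reindex_inj (inv_inj (@invgK _))) /=.
apply: eq_big => [[p q]|[p q]]; rewrite in_setX /= ?groupV // => /andP[pXY qYZ].
have pVXY := groupVr pXY; have qVYZ := groupVr qYZ.
rewrite /F /c /= tensor_stabE //= scalerA scalerA.
have := card_tensor_orbit sL sM pVXY qVYZ; have := card_tensor_class M sL q^-1%g pVXY.
rewrite !invgK => /(congr1 (fun n => n%:R : k)) + /(congr1 (fun n => n%:R : k)).
have := natr_card_neq0 X; have := natr_card_neq0 Y; have := natr_card_neq0 Z.
rewrite !natrM => Z0 Y0 X0 ew eo; congr (_ *: _).
rewrite [#|X|%:R * _ * _]mulrAC -ew -eo.
move: (Y0) (mulf_neq0 X0 Z0); rewrite -ew -eo !mulf_eq0 !negb_or.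
by move=> /andP[w0 m0] /andP[o0 s0]; field; rewrite w0 m0 o0 s0.
Qed.
End Formula.

Lemma sumv_ind (K : fieldType) (vT : vectType K) (I : finType) (P : pred I)
    (U : I -> {vspace vT}) (Q : vT -> Prop) :
  Q 0 -> (forall u v, Q u -> Q v -> Q (u + v)) ->
  (forall i v, P i -> v \in U i -> Q v) ->
  forall v, v \in (\sum_(i | P i) U i)%VS -> Q v.
Proof.
move=> Q0 QD QU v /memv_sumP[vs vsU ->].
by elim/big_ind: _ => // i Pi; apply: (QU i) => //; apply: vsU.
Qed.

(** * Fixed-point characters and the convolution formula *)

Section Characters.
Variables (k : fieldType) (gT : finGroupType).
Local Notation pT := (gT * gT)%type.
Local Notation Bv := (Bvec k gT).
Implicit Types (L M : {group pT}) (X Y Z G A B : {group gT}) (x y u v : Bv).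

Lemma kB_ind X Y (Q : Bv -> Prop) :
  Q 0 -> (forall a u v, Q u -> Q v -> Q (a *: u + v)) ->
  (forall L, L \subset setX X Y -> Q (eB k X Y L)) ->
  forall v, v \in kB k X Y -> Q v.
Proof.
move=> Q0 QZ Qe; apply: sumv_ind => // [u v Qu Qv | L v sL /vlineP[a ->]].
  by rewrite -[u]scale1r; apply: QZ.
by rewrite -[_ *: _]addr0; apply: QZ => //; apply: Qe.
Qed.

Lemma IG_ind G (Q : Bv -> Prop) :
  Q 0 -> (forall a u v, Q u -> Q v -> Q (a *: u + v)) ->
  (forall A B, A \subset G -> B \subset G -> Q (eB k G G (setX A B))) ->
  forall v, v \in IG k G -> Q v.
Proof.
move=> Q0 QZ Qe.
have QD u v : Q u -> Q v -> Q (u + v) by move=> Qu Qv; rewrite -[u]scale1r; apply: QZ.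
apply: sumv_ind => // A v sA; apply: sumv_ind => // {}v B sB /vlineP[a ->].
by rewrite -[_ *: _]addr0; apply: QZ => //; apply: Qe.
Qed.

Lemma IcG_ind G (Q : Bv -> Prop) :
  Q 0 -> (forall a u v, Q u -> Q v -> Q (a *: u + v)) ->
  (forall A B, (A \subset G) && cyclic A -> (B \subset G) && cyclic B ->
     Q (eB k G G (setX A B))) ->
  forall v, v \in IcG k G -> Q v.
Proof.
move=> Q0 QZ Qe.
have QD u v : Q u -> Q v -> Q (u + v) by move=> Qu Qv; rewrite -[u]scale1r; apply: QZ.
apply: sumv_ind => // A v sA; apply: sumv_ind => // {}v B sB /vlineP[a ->].
by rewrite -[_ *: _]addr0; apply: QZ => //; apply: Qe.
Qed.

Lemma mem_kB X Y L : L \subset setX X Y -> eB k X Y L \in kB k X Y.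
Proof. by move=> sL; apply: (subvP (sumv_sup L sL (subvv _))); apply: memv_line. Qed.

Lemma mem_IG G A B : A \subset G -> B \subset G -> eB k G G (setX A B) \in IG k G.
Proof.
move=> sA sB; apply: (subvP (sumv_sup A sA (subvv _))).
by apply: (subvP (sumv_sup B sB (subvv _))); apply: memv_line.
Qed.

Lemma mem_IcG G A B : (A \subset G) && cyclic A -> (B \subset G) && cyclic B ->
  eB k G G (setX A B) \in IcG k G.
Proof.
move=> sA sB; apply: (subvP (sumv_sup A sA (subvv _))).
by apply: (subvP (sumv_sup B sB (subvv _))); apply: memv_line.
Qed.

Lemma IcG_sub_IG G : (IcG k G <= IG k G)%VS.
Proof.
apply/subvP; apply: IcG_ind => [|a u v|A B /andP[sA _] /andP[sB _]].
- exact: mem0v.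
- by move=> uI vI; rewrite memvD ?memvZ.
exact: mem_IG.
Qed.

Lemma IG_sub_kB G : (IG k G <= kB k G G)%VS.
Proof.
apply/subvP; apply: IG_ind => [|a u v|A B sA sB].
- exact: mem0v.
- by move=> uI vI; rewrite memvD ?memvZ.
by apply: mem_kB; apply: setXS.
Qed.

Lemma bcls_conj X Y (L : {set pT}) r : r \in setX X Y ->
  bcls X Y (L :^ r)%g = bcls X Y L.
Proof. by move=> rXY; rewrite /bcls conjugates_conj lcoset_id. Qed.

Lemma eB_conj X Y (L : {set pT}) r : r \in setX X Y ->
  eB k X Y (L :^ r)%g = eB k X Y L.
Proof. by move=> rXY; rewrite /eB bcls_conj. Qed.

(** [bmul] and [chi] read a class through a chosen representative, controlled only up to conjugacy;
    this is combined with the conjugation invariance of [marks] and [bcomp]. *)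
Lemma pick_cls_bcls X Y (L : {set pT}) :
  exists2 r, r \in setX X Y & pick_cls (bcls X Y L) = (L :^ r)%g.
Proof.
rewrite /pick_cls; case: pickP => [M /imsetP[r rXY ->] | /(_ L)]; first by exists r.
by move=> /negbT/negP[]; apply/imsetP; exists 1%g; rewrite ?group1 ?conjsg1.
Qed.

Lemma sum_eB (V : lmodType k) X Y (L : {set pT}) (f : cls_index gT -> V) :
  \sum_C eB k X Y L C *: f C = f (bcls X Y L).
Proof.
rewrite (bigD1 (bcls X Y L)) //= big1 ?addr0 ?ffunE ?eqxx ?scale1r // => C nC.
by rewrite ffunE (negbTE nC) scale0r.
Qed.

(* For a subgroup L of H, the number of fixed points of p on H/L. *)
Definition marks (T : finGroupType) (H L : {set T}) (p : T) : k :=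
  #|L|%:R^-1 * \sum_(r in H) (p \in L :^ r)%g%:R.

Lemma marks_conj (T : finGroupType) (H : {group T}) (L : {set T}) p r :
  r \in H -> marks H (L :^ r)%g p = marks H L p.
Proof.
move=> rH; rewrite /marks cardJg; congr (_ * _).
rewrite [RHS](reindex_inj (mulgI r)) /=.
by apply: eq_big => s; rewrite ?groupMl // conjsgM.
Qed.

Lemma marks_conjg (T : finGroupType) (H : {group T}) (L : {set T}) p r :
  r \in H -> marks H L (p ^ r)%g = marks H L p.
Proof.
move=> rH; rewrite /marks; congr (_ * _).
rewrite (reindex_inj (mulIg r)) /=.
by apply: eq_big => s; rewrite ?groupMr // conjsgM memJ_conjg.
Qed.

Lemma marks_setX (X Y A B : {set gT}) p :
  marks (setX X Y) (setX A B) p = marks X A p.1 * marks Y B p.2.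
Proof.
rewrite /marks cardsX natrM invfM mulrACA; congr (_ * _).
rewrite big_distrlr /= pair_big /=; apply: eq_big => [[a b]|[a b] _].
  by rewrite in_setX.
by rewrite setX_conj; case: p => g h; rewrite in_setX -natrM mulnb.
Qed.

Definition chi X Y (x : Bv) (p : pT) : k :=
  \sum_C x C * marks (setX X Y) (pick_cls C) p.

Lemma chi0 X Y p : chi X Y 0 p = 0.
Proof. by rewrite /chi big1 // => C _; rewrite ffunE mul0r. Qed.

Lemma chi_lin X Y a u v p : chi X Y (a *: u + v) p = a * chi X Y u p + chi X Y v p.
Proof.
rewrite /chi mulr_sumr -big_split /=; apply: eq_bigr => C _.
by rewrite !ffunE mulrDl -mulrA.
Qed.

Lemma chiZ X Y a u p : chi X Y (a *: u) p = a * chi X Y u p.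
Proof. by rewrite -[a *: u]addr0 chi_lin chi0 addr0. Qed.

Lemma chiD X Y u v p : chi X Y (u + v) p = chi X Y u p + chi X Y v p.
Proof. by rewrite -[u]scale1r chi_lin mul1r scale1r. Qed.

Lemma chi_sum X Y (I : Type) (r : seq I) (P : pred I) (F : I -> Bv) p :
  chi X Y (\sum_(i <- r | P i) F i) p = \sum_(i <- r | P i) chi X Y (F i) p.
Proof. by apply: (big_morph (fun u => chi X Y u p)); [move=> u v; apply: chiD | apply: chi0]. Qed.

Lemma chi_eB X Y (L : {set pT}) p : chi X Y (eB k X Y L) p = marks (setX X Y) L p.
Proof.
rewrite /chi (sum_eB (V := k^o) X Y L (fun C => marks (setX X Y) (pick_cls C) p)).
by case: (pick_cls_bcls X Y L) => r rXY ->; apply: marks_conj.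
Qed.

Lemma bmul0l (X Y Z : {set gT}) y : bmul X Y Z 0 y = 0.
Proof. by rewrite /bmul big1 // => C _; rewrite big1 // => D _; rewrite ffunE mul0r scale0r. Qed.

Lemma bmul0r (X Y Z : {set gT}) x : bmul X Y Z x 0 = 0.
Proof. by rewrite /bmul big1 // => C _; rewrite big1 // => D _; rewrite ffunE mulr0 scale0r. Qed.

Lemma bmul_linl (X Y Z : {set gT}) a u v y :
  bmul X Y Z (a *: u + v) y = a *: bmul X Y Z u y + bmul X Y Z v y.
Proof.
rewrite /bmul scaler_sumr -big_split; apply: eq_bigr => C _ /=.
rewrite scaler_sumr -big_split; apply: eq_bigr => D _ /=.
by rewrite !ffunE scalerA -scalerDl mulrDl -mulrA.
Qed.

Lemma bmul_linr (X Y Z : {set gT}) a u v x :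
  bmul X Y Z x (a *: u + v) = a *: bmul X Y Z x u + bmul X Y Z x v.
Proof.
rewrite /bmul scaler_sumr -big_split; apply: eq_bigr => C _ /=.
rewrite scaler_sumr -big_split; apply: eq_bigr => D _ /=.
by rewrite !ffunE scalerA -scalerDl mulrDr [a *: _ in LHS]mulrC mulrA [_ * a]mulrC.
Qed.

Hypothesis char0 : [pchar k] =i pred0.

(** In the averaged Mackey formula, conjugating [L] and [M] only translates the summation
    variables. *)
Lemma bcomp_conj X Y Z L M r s : L \subset setX X Y -> M \subset setX Y Z ->
  r \in setX X Y -> s \in setX Y Z ->
  bcomp k X Y Z (L :^ r)%g (M :^ s)%g = bcomp k X Y Z L M.
Proof.
move=> sL sM rXY sYZ.
have sLr : (L :^ r)%G \subset setX X Y by rewrite -(conjGid rXY) conjSg.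
have sMs : (M :^ s)%G \subset setX Y Z by rewrite -(conjGid sYZ) conjSg.
rewrite (bcompE char0 sLr sMs) (bcompE char0 sL sM) /= !cardJg; congr (_ *: _).
rewrite [RHS](reindex_inj (mulgI r)) /=; apply: eq_big => p; first by rewrite groupMl.
move=> _; rewrite [RHS](reindex_inj (mulgI s)) /=; apply: eq_big => q; first by rewrite groupMl.
by rewrite -!conjsgM.
Qed.

Lemma bmul_eB X Y Z L M : L \subset setX X Y -> M \subset setX Y Z ->
  bmul X Y Z (eB k X Y L) (eB k Y Z M) = bcomp k X Y Z L M.
Proof.
move=> sL sM; rewrite /bmul.
under eq_bigr do under eq_bigr do rewrite -scalerA.
under eq_bigr do rewrite -scaler_sumr sum_eB.
rewrite (sum_eB X Y L (fun C => bcomp k X Y Z (pick_cls C) (pick_cls (bcls Y Z M)))).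
have [r rXY ->] := pick_cls_bcls X Y L; have [s sYZ ->] := pick_cls_bcls Y Z M.
exact: bcomp_conj.
Qed.

Lemma bmul_kB X Y Z x y : x \in kB k X Y -> y \in kB k Y Z ->
  bmul X Y Z x y \in kB k X Z.
Proof.
move=> xkB ykB; elim/kB_ind: x / xkB => [|a u v uP vP|L sL].
- by rewrite bmul0l mem0v.
- by rewrite bmul_linl memvD ?memvZ.
elim/kB_ind: y / ykB => [|a u v uP vP|M sM].
- by rewrite bmul0r mem0v.
- by rewrite bmul_linr memvD ?memvZ.
rewrite bmul_eB // bcompE // memvZ // memv_suml // => p pXY.
rewrite memv_suml // => q qYZ; rewrite memvZ //.
apply: (mem_kB (L := star_group (L :^ p)%G (M :^ q)%G)); apply: (star_sub (Y := Y)).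
  by rewrite -(conjGid pXY) conjSg.
by rewrite -(conjGid qYZ) conjSg.
Qed.

(** Up to normalisation both sides count triples [(p, q, h)] with [(g, h)] in [L :^ p] and [(h, z)]
    in [M :^ q]: on the left by the averaged Mackey formula, on the right by expanding the two
    marks. *)
Lemma chi_bcomp X Y Z L M g z : L \subset setX X Y -> M \subset setX Y Z ->
  chi X Z (bcomp k X Y Z L M) (g, z) =
  #|Y|%:R^-1 * \sum_(h in Y) marks (setX X Y) L (g, h) * marks (setX Y Z) M (h, z).
Proof.
move=> sL sM; rewrite bcompE // chiZ chi_sum.
pose Phi (p q : pT) : k :=
  #|[set h | ((g, h) \in L :^ p)%g && ((h, z) \in M :^ q)%g]|%:R.
(* The factor $|star|$ cancels the denominator of the mark, and $|midker|$ times membership in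
   [star] counts middle elements. Conjugation by [r] acts on the outer coordinates only, so it is
   absorbed into [p] and [q]; the sum over [r] then contributes $|X||Z|$. *)
have termE (p q : pT) :
    chi X Z ((#|midker (L :^ p)%g (M :^ q)%g| * #|star (L :^ p)%g (M :^ q)%g|)%:R
         *: eB k X Z (star (L :^ p)%g (M :^ q)%g)) (g, z)
    = \sum_(r in setX X Z) Phi (p * (r.1, 1))%g (q * (1, r.2))%g.
  rewrite chiZ chi_eB /marks natrM -mulrA mulVKf; last first.
    exact: (natr_card_neq0 char0 (star_group (L :^ p)%G (M :^ q)%G)).
  rewrite mulr_sumr; apply: eq_bigr => r _.
  rewrite (star_conj (L :^ p)%G (M :^ q)%G) -(midker_conj (L :^ p)%G (M :^ q)%G r).
  by rewrite -natrM mulnC -card_star_fiber /Phi !conjsgM.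
have -> : \sum_(p in setX X Y) chi X Z (\sum_(q in setX Y Z)
       (#|midker (L :^ p)%g (M :^ q)%g| * #|star (L :^ p)%g (M :^ q)%g|)%:R
         *: eB k X Z (star (L :^ p)%g (M :^ q)%g)) (g, z)
    = (#|X| * #|Z|)%:R * \sum_(p in setX X Y) \sum_(q in setX Y Z) Phi p q.
  under eq_bigr => p _ do rewrite chi_sum; under eq_bigr => p _ do under eq_bigr => q _ do rewrite termE.
  under eq_bigr => p _ do rewrite exchange_big.
  rewrite exchange_big -cardsX -sum1_card natr_sum mulr_suml /=; apply: eq_bigr => r rXZ.
  have [rX rZ] : r.1 \in X /\ r.2 \in Z by case: r rXZ => a b; rewrite in_setX => /andP.
  rewrite mul1r [RHS](reindex_inj (mulIg ((r.1, 1) : pT)%g)) /=.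
  apply: eq_big => p; first by rewrite groupMr // in_setX rX group1.
  move=> _; rewrite [RHS](reindex_inj (mulIg ((1, r.2) : pT)%g)) /=.
  by apply: eq_big => q; first by rewrite groupMr // in_setX rZ group1.
have PhiE p q : p \in setX X Y ->
    Phi p q = \sum_(h in Y) ((g, h) \in L :^ p)%g%:R * ((h, z) \in M :^ q)%g%:R.
  move=> pXY; rewrite /Phi -sum1dep_card natr_sum big_mkcond /= [RHS]big_mkcond /=.
  apply: eq_bigr => h _; rewrite -natrM mulnb.
  case: (boolP (h \in Y)) => [_|nY]; first by case: (_ && _).
  case: (boolP ((g, h) \in _)) => //= ghL; case/negP: nY.
  have /subsetP/(_ _ ghL) : (L :^ p)%g \subset setX X Y by rewrite -(conjGid pXY) conjSg.
  by rewrite in_setX => /andP[].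
have -> : \sum_(h in Y) marks (setX X Y) L (g, h) * marks (setX Y Z) M (h, z)
    = (#|L| * #|M|)%:R^-1 * \sum_(p in setX X Y) \sum_(q in setX Y Z) Phi p q.
  under [in RHS]eq_bigr => p pXY do under eq_bigr => q _ do rewrite PhiE //.
  under [in RHS]eq_bigr => p pXY do rewrite exchange_big.
  rewrite exchange_big mulr_sumr; apply: eq_bigr => h _ /=.
  by rewrite /marks mulrACA natrM invfM big_distrlr.
rewrite !mulrA; congr (_ * _); rewrite !natrM.
by field; rewrite !natr_card_neq0.
Qed.

Lemma chi_bmul X Y Z x y g z : x \in kB k X Y -> y \in kB k Y Z ->
  chi X Z (bmul X Y Z x y) (g, z) =
  #|Y|%:R^-1 * \sum_(h in Y) chi X Y x (g, h) * chi Y Z y (h, z).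
Proof.
move=> xkB ykB; elim/kB_ind: x / xkB => [|a u v uP vP|L sL].
- by rewrite bmul0l chi0 big1 ?mulr0 // => h _; rewrite chi0 mul0r.
- rewrite bmul_linl chi_lin uP vP mulrCA mulr_sumr -mulrDr -big_split /=.
  by congr (_ * _); apply: eq_bigr => h _; rewrite chi_lin mulrDl mulrA.
elim/kB_ind: y / ykB => [|a u v uP vP|M sM].
- by rewrite bmul0r chi0 big1 ?mulr0 // => h _; rewrite chi0 mulr0.
- rewrite bmul_linr chi_lin uP vP mulrCA mulr_sumr -mulrDr -big_split /=.
  by congr (_ * _); apply: eq_bigr => h _; rewrite chi_lin mulrDr mulrCA.
rewrite bmul_eB // chi_bcomp //; congr (_ * _).
by apply: eq_bigr => h _; rewrite !chi_eB.
Qed.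

End Characters.

(** * The identity biset, products in the ideal I(G), and the pairing with permutation characters *)

Section Products.
Variables (k : fieldType) (gT : finGroupType).
Local Notation pT := (gT * gT)%type.
Local Notation Bv := (Bvec k gT).
Local Notation one := (one_grp gT).
Implicit Types (L M : {group pT}) (X Y Z G A B : {group gT}) (x y u v psi : Bv).
Hypothesis char0 : [pchar k] =i pred0.

Local Notation theta G B := (marks k (gval G) (gval B)).

(** The point stabiliser of the identity biset [G]. *)
Definition diag (G : {set gT}) : {set pT} := [set (g, g) | g in G].

Lemma mem_diag (G : {set gT}) p : (p \in diag G) = (p.1 \in G) && (p.1 == p.2).
Proof.
case: p => g h; apply/imsetP/andP => [[t tG [-> ->]] | [/= gG /eqP<-]]; first by rewrite tG.
by exists g.
Qed.

Lemma diag_group_set G : group_set (diag G).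
Proof.
apply/group_setP; split; first by rewrite mem_diag group1 /=.
move=> [g h] [g' h']; rewrite !mem_diag /= => /andP[gG /eqP<-] /andP[g'G /eqP<-].
by rewrite groupM /=.
Qed.
Canonical diag_group G := Group (diag_group_set G).

Lemma diag_sub G : diag G \subset setX G G.
Proof. by apply/subsetP=> -[g h]; rewrite mem_diag in_setX /= => /andP[gG /eqP<-]; rewrite gG. Qed.

Lemma mem_diag_conj G (q : pT) h z : q \in setX G G -> h \in G ->
  ((h, z) \in diag G :^ q)%g = (z == h ^ (q.1^-1 * q.2))%g.
Proof.
case: q => a b; rewrite in_setX => /andP[aG bG] hG; rewrite mem_conjg.
have -> : ((h, z) ^ (a, b)^-1 = (h ^ a^-1, z ^ b^-1))%g by [].
rewrite mem_diag groupJ ?groupV //= conjgM -[RHS](inj_eq (conjg_inj b^-1%g)) conjgK.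
by rewrite eq_sym.
Qed.

(** Characters do not separate elements of kB(X,G) in general, so the argument goes through the
    Mackey formula. A conjugate of the diagonal is the graph of an inner automorphism: composing
    with it conjugates [L] in the second coordinate, with trivial [midker], and every term is the
    class of [L]. *)
Lemma bmul_idr X G x : x \in kB k X G -> bmul X G G x (eB k G G (diag G)) = x.
Proof.
elim/kB_ind => [|c u v uP vP|L sL]; first by rewrite bmul0l.
  by rewrite bmul_linl uP vP.
rewrite bmul_eB ?diag_sub // bcompE ?diag_sub //.
have starE p q : p \in setX X G -> q \in setX G G ->
    star (L :^ p)%g (diag G :^ q)%g = (L :^ (p * (1, q.1^-1 * q.2)))%g.
  move=> pXG qG; apply/setP=> -[g z]; rewrite inE conjsgM mem_conjg /=.
  set c := (q.1^-1 * q.2)%g.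
  have -> : ((g, z) ^ (1, c)^-1 = (g, z ^ c^-1))%g.
    by congr (_, _); rewrite /= ?invg1 ?mul1g ?mulg1.
  have memY h : ((g, h) \in L :^ p)%g -> h \in G.
    have /subsetP sLp : (L :^ p)%g \subset setX X G by rewrite -(conjGid pXG) conjSg.
    by move/sLp; rewrite in_setX => /andP[].
  apply/existsP/idP => [[h /andP[ghL]] | gzL].
    by rewrite mem_diag_conj ?(memY h) // => /eqP->; rewrite conjgK.
  by exists (z ^ c^-1)%g; rewrite gzL mem_diag_conj ?(memY _ gzL) //= conjgKV.
have kerE p q : q \in setX G G -> midker (L :^ p)%g (diag G :^ q)%g = [set 1%g].
  move=> qG; apply/setP=> h; rewrite !inE; apply/andP/eqP => [[_] | ->]; last first.
    by rewrite !(group1 (_ :^ _)%G).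
  have /subsetP sD : (diag G :^ q)%g \subset setX G G.
    by rewrite -(conjGid qG) conjSg diag_sub.
  move=> hD; move: (hD); rewrite mem_diag_conj //; last first.
    by move/sD: hD; rewrite in_setX => /andP[].
  by move/eqP=> h1; apply: (@conjg_inj _ (q.1^-1 * q.2)%g); rewrite -h1 conj1g.
rewrite (eq_bigr (fun=> (#|G| * #|G| * #|L|)%:R *: eB k X G L)) => [|p pXG].
  rewrite sumr_const -scaler_nat !scalerA cardsX card_in_imset; last by move=> ? ? _ _ [].
  rewrite -[RHS]scale1r; congr (_ *: _); rewrite !natrM; field.
  by rewrite !natr_card_neq0.
rewrite (eq_bigr (fun=> #|L|%:R *: eB k X G L)) => [|q qG].
  by rewrite sumr_const -scaler_nat scalerA cardsX -natrM.
rewrite kerE // starE // cards1 mul1n cardJg eB_conj // groupM // in_setX group1.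
by case: q qG => ? ?; rewrite in_setX => /andP[? ?]; rewrite groupM ?groupV.
Qed.

Lemma star_setX (A B C D : {group gT}) :
  star (setX A B) (setX C D) = setX A D.
Proof.
apply/setP=> -[g z]; rewrite inE in_setX.
apply/existsP/andP => [[h] | [gA zD]].
  by rewrite !in_setX => /andP[/andP[-> _] /andP[_ ->]].
by exists 1%g; rewrite !in_setX /= gA zD !group1.
Qed.

(** All stabilisers in the Mackey formula are conjugate to [setX A D], so the product is a multiple
    of one class. The scalar is read off from characters at the identity, where permutation
    characters are nonzero in characteristic zero. *)
Lemma bmul_setX X Y Z (A B C D : {group gT}) :
  A \subset X -> B \subset Y -> C \subset Y -> D \subset Z ->
  bmul X Y Z (eB k X Y (setX A B)) (eB k Y Z (setX C D)) =
  (#|Y|%:R^-1 * \sum_(h in Y) theta Y B h * theta Y C h) *: eB k X Z (setX A D).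
Proof.
move=> sA sB sC sD; have sAB := setXS sA sB; have sCD := setXS sC sD.
rewrite bmul_eB //.
have [s sE] : exists s, bcomp k X Y Z (setX A B) (setX C D) = s *: eB k X Z (setX A D).
  rewrite bcompE //.
  pose m p q : k := (#|midker (setX A B :^ p)%g (setX C D :^ q)%g| * #|star (setX A B :^ p)%g (setX C D :^ q)%g|)%:R.
  exists ((#|X| * #|Y| * #|Z| * (#|setX A B| * #|setX C D|))%:R^-1 *
    \sum_(p in setX X Y) \sum_(q in setX Y Z) m p q).
  rewrite -[RHS]scalerA; congr (_ *: _); rewrite scaler_suml.
  apply: eq_bigr => p pXY; rewrite scaler_suml; apply: eq_bigr => q qYZ.
  rewrite /m !setX_conj (star_setX (A :^ _)%G (B :^ _)%G (C :^ _)%G (D :^ _)%G) /=.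
  congr (_ *: _); rewrite -(setX_conj A D (p.1, q.2)) eB_conj // in_setX /=.
  by case: p q pXY qYZ => ? ? [? ?]; rewrite !in_setX => /andP[-> _] /andP[].
rewrite sE; congr (_ *: _).
have := congr1 (fun u => chi X Z u (1%g, 1%g)) sE; rewrite chi_bcomp // chiZ chi_eB.
have th1 (H K : {group gT}) : theta H K 1%g != 0.
  rewrite /marks mulf_neq0 ?invr_eq0 ?natr_card_neq0 //.
  rewrite (eq_bigr (fun=> 1)) => [|r _]; last by rewrite (group1 (K :^ r)%G).
  by rewrite sumr_const natr_card_neq0.
rewrite marks_setX /= => sE2.
apply: (mulIf (mulf_neq0 (th1 X A) (th1 Z D))); rewrite -sE2 -mulrA; congr (_ * _).
rewrite mulr_suml; apply: eq_bigr => h _; rewrite !marks_setX /=; ring.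
Qed.

Lemma bmul_IG G x u : x \in kB k G G -> u \in IG k G -> bmul G G G x u \in IG k G.
Proof.
move=> xkB uI; elim/kB_ind: x / xkB => [|c y v yP vP|L sL].
- by rewrite bmul0l mem0v.
- by rewrite bmul_linl memvD ?memvZ.
elim/IG_ind: u / uI => [|c y v yP vP|A B sA sB].
- by rewrite bmul0r mem0v.
- by rewrite bmul_linr memvD ?memvZ.
have sAB := setXS sA sB; rewrite bmul_eB // bcompE // memvZ // memv_suml // => p pG.
rewrite memv_suml // => q qG; rewrite memvZ //.
have [qG1 qG2] : q.1 \in G /\ q.2 \in G by case: q qG => ? ?; rewrite in_setX => /andP.
(* [S] is the image of [A :^ q.1] under the relation [L :^ p]; composing that relation with a
   product subgroup again gives a product subgroup. *)
pose S := [set g | [exists h in (A :^ q.1)%g, (g, h) \in (L :^ p)%g]].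
have gS : group_set S.
  apply/group_setP; split.
    rewrite inE; apply/existsP; exists 1%g.
    by rewrite (group1 (A :^ q.1)%G) (group1 (L :^ p)%G).
  move=> g g'; rewrite !inE => /existsP[h /andP[hA ghL]] /existsP[h' /andP[hA' ghL']].
  apply/existsP; exists (h * h')%g; rewrite (groupM (G := (A :^ _)%G) hA hA') /=.
  exact: (groupM (G := (L :^ p)%G) ghL ghL').
have -> : star (L :^ p)%g (setX A B :^ q)%g = setX (Group gS) (B :^ q.2)%G.
  apply/setP=> -[g z]; rewrite setX_conj !inE /=.
  apply/existsP/andP => [[h /andP[ghL]] | [/existsP[h /andP[hA ghL]] zB]].
    by rewrite in_setX => /andP[hA ->]; split=> //; apply/existsP; exists h; rewrite hA.
  by exists h; rewrite ghL in_setX hA.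
apply: mem_IG; last by rewrite -(conjGid qG2) conjSg.
apply/subsetP=> g; rewrite inE => /existsP[h /andP[_ ghL]].
have /subsetP/(_ _ ghL) : (L :^ p)%g \subset setX G G by rewrite -(conjGid pG) conjSg.
by rewrite in_setX => /andP[].
Qed.

(** For $w = \theta_B$ and $w' = \theta_C$ this is $|G|^2$ times the scalar by which
    $e_{1,B}\,a\,e_{C,1}$ acts in kB(1,1). *)
Definition sandwich G (w w' : gT -> k) (a : Bv) : k :=
  \sum_(g in G) \sum_(h in G) w g * chi G G a (g, h) * w' h.

Lemma sandwich0 G w w' : sandwich G w w' 0 = 0.
Proof.
by rewrite /sandwich big1 // => g _; rewrite big1 // => h _; rewrite chi0 mulr0 mul0r.
Qed.

Lemma sandwich_lin G w w' c u v :
  sandwich G w w' (c *: u + v) = c * sandwich G w w' u + sandwich G w w' v.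
Proof.
rewrite /sandwich mulr_sumr -big_split; apply: eq_bigr => g _ /=.
rewrite mulr_sumr -big_split; apply: eq_bigr => h _ /=; rewrite chi_lin; ring.
Qed.

Lemma sandwich_setX G w w' A B :
  sandwich G w w' (eB k G G (setX A B)) =
  (\sum_(g in G) w g * theta G A g) * (\sum_(h in G) theta G B h * w' h).
Proof.
rewrite /sandwich big_distrlr /=; apply: eq_bigr => g _; apply: eq_bigr => h _.
by rewrite chi_eB marks_setX /=; ring.
Qed.

Lemma bmul_eB_IG_eB G (A B C D : {group gT}) u :
  A \subset G -> B \subset G -> C \subset G -> D \subset G -> u \in IG k G ->
  bmul G G G (eB k G G (setX A B)) (bmul G G G u (eB k G G (setX C D)))
   = (#|G|%:R^-1 ^+ 2 * sandwich G (theta G B) (theta G C) u) *: eB k G G (setX A D).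
Proof.
move=> sA sB sC sD; elim/IG_ind => [|c x v xP vP|E F sE sF].
- by rewrite bmul0l bmul0r sandwich0 mulr0 scale0r.
- by rewrite bmul_linl bmul_linr xP vP sandwich_lin scalerA -scalerDl; congr (_ *: _); ring.
rewrite bmul_setX // -[_ *: eB _ _ _ _]addr0 bmul_linr bmul0r addr0 bmul_setX // scalerA.
by rewrite sandwich_setX; congr (_ *: _); ring.
Qed.

(** * Bisets with the trivial group on one side, and the module $S_{1,k}(G)$ *)

Lemma sub_setX1 G L : L \subset setX one G ->
  exists2 B : {group gT}, B \subset G & L :=: setX one B.
Proof.
move=> sL; have gS : group_set [set h | (1%g, h) \in L].
  apply/group_setP; split; first by rewrite inE (group1 L).
  move=> h h'; rewrite !inE => hL h'L.
  have -> : (1, h * h')%g = ((1, h) * (1, h'))%g :> pT by congr (_, _); rewrite /= mulg1.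
  exact: groupM.
exists (Group gS).
  by apply/subsetP=> h; rewrite inE => /(subsetP sL); rewrite in_setX => /andP[].
apply/setP=> -[g h]; rewrite in_setX inE /=; apply/idP/andP => [ghL | []].
  have := subsetP sL _ ghL; rewrite in_setX => /andP[/set1P /= gE _]; subst g.
  by split; rewrite ?inE.
by rewrite inE => /eqP->.
Qed.

Lemma sub_setX_1 G L : L \subset setX G one ->
  exists2 B : {group gT}, B \subset G & L :=: setX B one.
Proof.
move=> sL; have gS : group_set [set h | (h, 1%g) \in L].
  apply/group_setP; split; first by rewrite inE (group1 L).
  move=> h h'; rewrite !inE => hL h'L.
  have -> : (h * h', 1)%g = ((h, 1) * (h', 1))%g :> pT by congr (_, _); rewrite /= mulg1.
  exact: groupM.
exists (Group gS).
  by apply/subsetP=> h; rewrite inE => /(subsetP sL); rewrite in_setX => /andP[].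
apply/setP=> -[h g]; rewrite in_setX inE /=; apply/idP/andP => [ghL | [+]].
  have := subsetP sL _ ghL; rewrite in_setX => /andP[_ /set1P /= gE]; subst g.
  by split; rewrite ?inE.
by move=> hL; rewrite inE => /eqP->.
Qed.

Lemma kB1G_ind G (Q : Bv -> Prop) :
  Q 0 -> (forall a u v, Q u -> Q v -> Q (a *: u + v)) ->
  (forall B, B \subset G -> Q (eB k one G (setX one B))) ->
  forall v, v \in kB k one G -> Q v.
Proof.
by move=> Q0 QZ Qe; apply: kB_ind => // L /sub_setX1[B sB ->]; apply: Qe.
Qed.

Lemma kBG1_ind G (Q : Bv -> Prop) :
  Q 0 -> (forall a u v, Q u -> Q v -> Q (a *: u + v)) ->
  (forall B, B \subset G -> Q (eB k G one (setX B one))) ->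
  forall v, v \in kB k G one -> Q v.
Proof.
by move=> Q0 QZ Qe; apply: kB_ind => // L /sub_setX_1[B sB ->]; apply: Qe.
Qed.

Lemma marks_one : marks k one one 1%g = 1.
Proof. by rewrite /marks cards1 invr1 mul1r big_set1 (group1 (one :^ _)%G). Qed.

Lemma chi_eB1G G B g : chi one G (eB k one G (setX one B)) (1%g, g) = theta G B g.
Proof. by rewrite chi_eB marks_setX /= marks_one mul1r. Qed.

Lemma chi_eBG1 G B g : chi G one (eB k G one (setX B one)) (g, 1%g) = theta G B g.
Proof. by rewrite chi_eB marks_setX /= marks_one mulr1. Qed.

Lemma mem_eB1G G B : B \subset G -> eB k one G (setX one B) \in kB k one G.
Proof. by move=> sB; apply: mem_kB; apply: setXS. Qed.

Lemma mem_eBG1 G B : B \subset G -> eB k G one (setX B one) \in kB k G one.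
Proof. by move=> sB; apply: mem_kB; apply: setXS. Qed.

Lemma kB11_eq0 v : v \in kB k one one -> chi one one v (1%g, 1%g) = 0 -> v = 0.
Proof.
move=> vkB v0; suff -> : v = chi one one v (1%g, 1%g) *: eB k one one (setX one one).
  by rewrite v0 scale0r.
elim/kB1G_ind: v / vkB {v0} => [|c u v uP vP|B].
- by rewrite chi0 scale0r.
- by rewrite chi_lin scalerDl -scalerA -uP -vP.
by move/trivGP=> ->; rewrite chi_eB1G marks_one scale1r.
Qed.

(** kB(1,G) is spanned by the classes of [setX one B], and products of its elements with [x] land in
    the line kB(1,1), where the character at the identity detects zero. *)
Lemma J1kP G x : x \in kB k G one ->
  J1k G x <-> (forall B, B \subset G ->
     \sum_(h in G) theta G B h * chi G one x (h, 1%g) = 0).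
Proof.
move=> xkB; split=> [[_ Jx] B sB | xB].
  have := Jx _ (mem_eB1G sB) => /(congr1 (fun u => chi one one u (1%g, 1%g))).
  rewrite chi0 chi_bmul ?mem_eB1G // => /eqP; rewrite mulf_eq0 invr_eq0.
  rewrite (negbTE (natr_card_neq0 char0 G)) /= => /eqP sum0.
  by rewrite -[RHS]sum0; apply: eq_bigr => h _; rewrite chi_eB1G.
split=> // psi psikB; apply: kB11_eq0; first exact: (bmul_kB char0 (Y := G)).
rewrite chi_bmul //; apply/eqP; rewrite mulf_eq0; apply/orP; right; apply/eqP.
elim/kB1G_ind: psi / psikB => [|c u v uP vP|B sB].
- by rewrite big1 // => h _; rewrite chi0 mul0r.
- have := congr2 +%R (congr1 ( *%R c) uP) vP; rewrite mulr0 addr0; apply: etrans.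
  rewrite mulr_sumr -big_split /=.
  by apply: eq_bigr => h _; rewrite chi_lin; ring.
by rewrite -[RHS](xB B sB); apply: eq_bigr => h _; rewrite chi_eB1G.
Qed.

Lemma sum_chi_bmul G w (a x : Bv) : a \in kB k G G -> x \in kB k G one ->
  \sum_(g in G) w g * chi G one (bmul G G one a x) (g, 1%g) =
  #|G|%:R^-1 * sandwich G w (fun h => chi G one x (h, 1%g)) a.
Proof.
move=> akB xkB; rewrite /sandwich mulr_sumr; apply: eq_bigr => g _.
rewrite chi_bmul // mulrCA; congr (_ * _); rewrite mulr_sumr.
by apply: eq_bigr => h _; rewrite mulrA.
Qed.

Lemma sandwich_chi0 G w (a x : Bv) :
  (forall C : {group gT}, C \subset G -> sandwich G w (theta G C) a = 0) ->
  x \in kB k G one -> sandwich G w (fun h => chi G one x (h, 1%g)) a = 0.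
Proof.
move=> aC; elim/kBG1_ind => [|c u v uP vP|B sB].
- by rewrite /sandwich big1 // => g _; rewrite big1 // => h _; rewrite chi0 mulr0.
- have := congr2 +%R (congr1 ( *%R c) uP) vP; rewrite mulr0 addr0; apply: etrans.
  rewrite mulr_sumr -big_split /=.
  apply: eq_bigr => g _; rewrite mulr_sumr -big_split /=.
  by apply: eq_bigr => h _; rewrite chi_lin; ring.
rewrite -[RHS](aC B sB); apply: eq_bigr => g _; apply: eq_bigr => h _.
by rewrite chi_eBG1.
Qed.

Lemma chi0_sandwich G w' (a psi : Bv) :
  (forall B, B \subset G -> sandwich G (theta G B) w' a = 0) ->
  psi \in kB k one G -> sandwich G (fun h => chi one G psi (1%g, h)) w' a = 0.
Proof.
move=> aC; elim/kB1G_ind => [|c u v uP vP|B sB].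
- by rewrite /sandwich big1 // => g _; rewrite big1 // => h _; rewrite chi0 !mul0r.
- have := congr2 +%R (congr1 ( *%R c) uP) vP; rewrite mulr0 addr0; apply: etrans.
  rewrite mulr_sumr -big_split /=.
  apply: eq_bigr => g _; rewrite mulr_sumr -big_split /=.
  by apply: eq_bigr => h _; rewrite chi_lin; ring.
rewrite -[RHS](aC B sB); apply: eq_bigr => g _; apply: eq_bigr => h _.
by rewrite chi_eB1G.
Qed.

Lemma annS1kP G (a : Bv) : annS1k G a <->
  a \in kB k G G /\ forall B C : {group gT}, B \subset G -> C \subset G ->
    sandwich G (theta G B) (theta G C) a = 0.
Proof.
split=> -[akB aP]; split=> //.
  move=> B C sB sC.
  have bkB := bmul_kB char0 akB (mem_eBG1 sC).
  have /(J1kP bkB)/(_ B sB) := aP _ (mem_eBG1 sC).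
  rewrite sum_chi_bmul ?mem_eBG1 // => /eqP; rewrite mulf_eq0 invr_eq0.
  rewrite (negbTE (natr_card_neq0 char0 G)) /= => /eqP sum0.
  by rewrite -[RHS]sum0; apply: eq_bigr => g _; apply: eq_bigr => h _; rewrite chi_eBG1.
move=> x xkB; apply/(J1kP (bmul_kB char0 akB xkB)) => B sB.
rewrite sum_chi_bmul // sandwich_chi0 ?mulr0 // => C sC; exact: aP.
Qed.

End Products.

(** * Artin induction and the complement $I_c(G)$ *)

Section Artin.
Variables (k : fieldType) (gT : finGroupType) (G : {group gT}).
Local Notation pT := (gT * gT)%type.
Local Notation Bv := (Bvec k gT).
Implicit Types (A B : {group gT}) (c u v : Bv).
Hypothesis char0 : [pchar k] =i pred0.

Local Notation theta B := (marks k (gval G) (gval B)).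

Lemma natr_neq0 n : (0 < n)%N -> n%:R != 0 :> k.
Proof. by rewrite (proj1 (pcharf0P k)) // lt0n. Qed.

Lemma marks_neq0 (T : finGroupType) (H L : {group T}) p r :
  r \in H -> (p \in L :^ r)%g -> marks k H L p != 0.
Proof.
move=> rH pL; rewrite /marks mulf_neq0 ?invr_eq0 ?natr_card_neq0 //.
by rewrite -natr_sum natr_neq0 // (bigD1 r) //= pL.
Qed.

Lemma marks_neq0_ex (T : finGroupType) (H L : {set T}) p :
  marks k H L p != 0 -> exists2 r, r \in H & (p \in L :^ r)%g.
Proof.
move=> nz; case: (boolP [exists r in H, p \in (L :^ r)%g]) => [/exists_inP // | no].
case/negP: nz; rewrite /marks big1 ?mulr0 // => r rH.
by case: (boolP (_ \in _)) => // pL; case/negP: no; apply/exists_inP; exists r.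
Qed.

(** A label for the rational class of [g]: equal labels mean that the generated cyclic subgroups are
    conjugate in [G]. *)
Definition cyc_cls (g : gT) : {set {set gT}} := (<[g]> :^: G)%g.

Lemma cyc_cls_conj g h r : r \in G -> (<[h]> = <[g]> :^ r)%g -> cyc_cls h = cyc_cls g.
Proof. by move=> rG eh; rewrite /cyc_cls eh conjugates_conj lcoset_id. Qed.

Lemma eq_cyc_cls g h : cyc_cls h = cyc_cls g -> exists2 r, r \in G & (<[h]> = <[g]> :^ r)%g.
Proof.
move=> e; have : <[h]>%g \in cyc_cls g.
  by rewrite -e; apply/imsetP; exists 1%g; rewrite ?group1 ?conjsg1.
by case/imsetP=> r rG eh; exists r.
Qed.

Lemma marks_cyc_cls B g h : cyc_cls h = cyc_cls g -> theta B h = theta B g.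
Proof.
case/eq_cyc_cls => r rG; rewrite -cycleJ => e; rewrite -(marks_conjg k B g rG) /marks.
congr (_ * _); apply: eq_bigr => s _; congr (nat_of_bool _)%:R.
by rewrite -!(cycle_subG _ (B :^ s)%G) e.
Qed.

Definition thetaf (B : {set gT}) : {ffun gT -> k^o} :=
  [ffun g => if g \in G then marks k G B g else 0].

Definition deltaf (g : gT) : {ffun gT -> k^o} :=
  [ffun h => ((h \in G) && (cyc_cls h == cyc_cls g))%:R].

Definition ncls g : k := #|[set h in G | cyc_cls h == cyc_cls g]|%:R.

Lemma ncls_neq0 g : g \in G -> ncls g != 0.
Proof.
move=> gG; apply: natr_neq0; apply/card_gt0P; exists g.
by rewrite inE gG eqxx.
Qed.

Lemma ncls_eq g h : cyc_cls h = cyc_cls g -> ncls h = ncls g.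
Proof. by rewrite /ncls => ->. Qed.

Lemma sum_deltaf g (f : gT -> k) :
  (forall h, h \in G -> cyc_cls h = cyc_cls g -> f h = f g) ->
  \sum_(h in G) deltaf g h * f h = ncls g * f g.
Proof.
move=> fP; rewrite /ncls -sum1dep_card natr_sum mulr_suml.
rewrite big_mkcond [RHS]big_mkcond /=; apply: eq_bigr => h _.
rewrite ffunE; case: (boolP (h \in G)) => //= hG.
by case: eqP => [e|_]; rewrite ?mul0r // fP.
Qed.

Lemma thetaf_deltaf B : thetaf B = \sum_(g in G) (theta B g / ncls g) *: deltaf g.
Proof.
apply/ffunP=> h; rewrite sum_ffunE ffunE; case: (boolP (h \in G)) => hG; last first.
  by rewrite big1 // => g _; rewrite !ffunE (negbTE hG) /= scaler0.
transitivity (\sum_(g in G) deltaf h g * (theta B g / ncls g)).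
  rewrite sum_deltaf => [|g gG e]; last by rewrite (marks_cyc_cls B e) (ncls_eq e).
  by rewrite mulrC divfK ?ncls_neq0.
apply: eq_bigr => g gG; rewrite !ffunE hG gG /= eq_sym.
by rewrite [RHS]mulrC.
Qed.

Definition Vc : {vspace {ffun gT -> k^o}} :=
  (\sum_(B : {group gT} | (B \subset G) && cyclic B) <[thetaf B]>)%VS.

(** Artin's theorem by triangularity, with induction on the order of [g]. The function [thetaf
    <[g]>] is nonzero at [g], and its other values sit on classes of elements of smaller order,
    already treated. *)
Lemma deltaf_in_Vc g : g \in G -> deltaf g \in Vc.
Proof.
move: {2}#[g]%g.+1 (ltnSn #[g]%g) => n; elim: n g => // n IH g gn gG.
have sgG : <[g]>%g \subset G by rewrite cycle_subG.
have th0 : theta <[g]>%G g != 0.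
  by apply: (marks_neq0 (group1 G)); rewrite conjsg1 cycle_id.
have thV : thetaf <[g]>%g \in Vc.
  apply: (subvP (sumv_sup <[g]>%G _ (subvv _))); first by rewrite sgG cycle_cyclic.
  exact: memv_line.
rewrite -[deltaf g](scalerK th0) memvZ //.
have -> : theta <[g]>%G g *: deltaf g = thetaf <[g]>%G
    - \sum_(h in G | cyc_cls h != cyc_cls g) (theta <[g]>%G h / ncls h) *: deltaf h.
  rewrite thetaf_deltaf (bigID (fun h => cyc_cls h == cyc_cls g)) /= addrK.
  rewrite (eq_bigr (fun=> (theta <[g]>%G g / ncls g) *: deltaf g)); last first.
    move=> h /andP[_ /eqP e]; rewrite (marks_cyc_cls _ e) (ncls_eq e).
    by congr (_ *: _); apply/ffunP=> t; rewrite !ffunE e.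
  rewrite sumr_const -scaler_nat scalerA; congr (_ *: _).
  have -> : #|[pred i in G | cyc_cls i == cyc_cls g]|%:R = ncls g.
    by rewrite /ncls; congr (_%:R); apply: eq_card => h; rewrite !inE.
  by rewrite mulrC divfK ?ncls_neq0.
rewrite memvB // memv_suml // => h /andP[hG ncl].
have [->|nz] := eqVneq (theta <[g]>%G h) 0; first by rewrite mul0r scale0r mem0v.
(* A nonzero value at [h] puts [<[h]>] inside a conjugate of [<[g]>]; equal orders would force equal
   classes, so the order drops. *)
have [r rG] := marks_neq0_ex nz; rewrite -(cycle_subG _ (<[g]> :^ r)%G) => shg.
rewrite memvZ // IH //; apply: leq_trans (ltnSE gn); rewrite ltn_neqAle.
have le := subset_leq_card shg; rewrite cardJg in le; rewrite [(#[h]%g <= #[g]%g)%N]le andbT.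
apply: contra ncl => /eqP eo; apply/eqP/(cyc_cls_conj rG)/eqP.
by rewrite eqEcard shg cardJg -[#|<[h]>%g|]/(#[h]%g) eo leqnn.
Qed.

(** The character of the class of [setX A B] is $\theta_A \otimes \theta_B$, so products of
    generators of [Vc] lift to generators of $I_c(G)$, and bilinearity does the rest. *)
Lemma lift_Vc (w w' : {ffun gT -> k^o}) : w \in Vc -> w' \in Vc ->
  exists2 c : Bv, c \in IcG k G & {in G &, forall g h, chi G G c (g, h) = w g * w' h}.
Proof.
move=> wV w'V; elim/sumv_ind: w / wV => [|w1 w2 [c1 c1I c1P] [c2 c2I c2P]|A w sA /vlineP[a ->]].
- by exists 0; [exact: mem0v | move=> g h _ _; rewrite chi0 ffunE mul0r].
- exists (c1 + c2); first exact: memvD.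
  by move=> g h gG hG; rewrite chiD c1P // c2P // ffunE mulrDl.
elim/sumv_ind: w' / w'V => [|w1 w2 [c1 c1I c1P] [c2 c2I c2P]|B w' sB /vlineP[b ->]].
- by exists 0; [exact: mem0v | move=> g h _ _; rewrite chi0 [(0 : {ffun _}) h]ffunE mulr0].
- exists (c1 + c2); first exact: memvD.
  by move=> g h gG hG; rewrite chiD c1P // c2P // [(w1 + w2) h]ffunE mulrDr.
exists ((a * b) *: eB k G G (setX A B)); first by rewrite memvZ ?mem_IcG.
by move=> g h gG hG; rewrite chiZ chi_eB marks_setX !ffunE gG hG /= mulrACA.
Qed.

Lemma sandwich_sum (I : Type) (r : seq I) (P : pred I) (F : I -> Bv) w w' :
  sandwich G w w' (\sum_(i <- r | P i) F i) = \sum_(i <- r | P i) sandwich G w w' (F i).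
Proof.
apply: (big_morph (sandwich G w w')); last exact: sandwich0.
by move=> u v; rewrite -[u]scale1r sandwich_lin mul1r scale1r.
Qed.

Lemma sandwichZ w w' a u : sandwich G w w' (a *: u) = a * sandwich G w w' u.
Proof. by rewrite -[a *: u]addr0 sandwich_lin sandwich0 addr0. Qed.

(* The witness is the lift of the average of [chi a] over the products of two
   classes of elements generating conjugate cyclic subgroups. *)
Lemma IcG_approx (a : Bv) : exists2 c : Bv, c \in IcG k G &
  forall B C : {group gT}, sandwich G (theta B) (theta C) c = sandwich G (theta B) (theta C) a.
Proof.
have liftP (p : pT) : exists2 c : Bv, c \in IcG k G & p \in setX G G ->
    {in G &, forall g h, chi G G c (g, h) = deltaf p.1 g * deltaf p.2 h}.
  case: (boolP (p \in setX G G)) => pG; last by exists 0; rewrite ?mem0v.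
  have [p1 p2] : p.1 \in G /\ p.2 \in G by case: p pG => ? ?; rewrite in_setX => /andP.
  by have [c cI cP] := lift_Vc (deltaf_in_Vc p1) (deltaf_in_Vc p2); exists c.
have [l lI lP] := fin_all_exists2 liftP.
exists (\sum_(p in setX G G) (chi G G a p / (ncls p.1 * ncls p.2)) *: l p).
  by rewrite memv_suml // => p _; rewrite memvZ.
move=> B C; rewrite sandwich_sum [in RHS]/sandwich [RHS]pair_big /=.
apply: eq_big => [[g h] | [g h]]; rewrite ?in_setX // => /andP[gG hG].
rewrite sandwichZ.
have -> : sandwich G (theta B) (theta C) (l (g, h))
    = (ncls g * theta B g) * (ncls h * theta C h).
  rewrite -(sum_deltaf (f := theta B)); last by move=> t tG e; apply: marks_cyc_cls.
  rewrite -(sum_deltaf (f := theta C)); last by move=> t tG e; apply: marks_cyc_cls.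
  rewrite big_distrlr /=; apply: eq_bigr => t tG; apply: eq_bigr => s sG.
  by rewrite lP ?in_setX ?gG //=; ring.
by field; rewrite !ncls_neq0.
Qed.

Lemma chi_IcG_cyc_cls c g h g' h' : c \in IcG k G -> cyc_cls g' = cyc_cls g ->
  cyc_cls h' = cyc_cls h -> chi G G c (g', h') = chi G G c (g, h).
Proof.
move=> cI eg eh; elim/IcG_ind: c / cI => [|a u v uP vP|A B _ _].
- by rewrite !chi0.
- by rewrite !chi_lin uP vP.
by rewrite !chi_eB !marks_setX /= (marks_cyc_cls A eg) (marks_cyc_cls B eh).
Qed.

Lemma IcG_supp c (C : cls_index gT) : c \in IcG k G -> c C != 0 ->
  exists AB : {group gT} * {group gT},
   [/\ (AB.1 \subset G) && cyclic AB.1, (AB.2 \subset G) && cyclic AB.2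
     & C = bcls G G (setX AB.1 AB.2)].
Proof.
elim/IcG_ind => [|a u v uP vP|A B sA sB]; first by rewrite ffunE eqxx.
  rewrite !ffunE; have [uC|/uP //] := eqVneq (u C) 0.
  by rewrite uC scaler0 add0r.
by rewrite ffunE; case: (C =P _) => [-> _|]; [exists (A, B) | rewrite eqxx].
Qed.

(** Triangularity on pairs of cyclic groups. Among the classes in the support of [c], take
    [setX A B] with $|A||B|$ maximal and evaluate at a pair of generators: any class contributing
    there contains a conjugate of [setX A B], hence equals its class by maximality, and a single
    nonzero term remains. *)
Lemma chi_IcG_inj c : c \in IcG k G ->
  {in G &, forall g h, chi G G c (g, h) = 0} -> c = 0.
Proof.
move=> cI chi_c0; apply/eqP/negPn/negP => c0.
pose P (AB : {group gT} * {group gT}) :=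
  [&& (AB.1 \subset G) && cyclic AB.1, (AB.2 \subset G) && cyclic AB.2
    & c (bcls G G (setX AB.1 AB.2)) != 0].
have [AB0 PAB0] : exists AB, P AB.
  have [C cC] : exists C, c C != 0.
    apply/existsP; apply: contraR c0 => /existsPn cC.
    by apply/eqP/ffunP=> C; rewrite ffunE; apply/eqP/negPn/cC.
  have [AB [sA sB CE]] := IcG_supp cI cC.
  by exists AB; rewrite /P sA sB -CE.
case: (arg_maxnP (fun AB : {group gT} * {group gT} => #|AB.1| * #|AB.2|)%N PAB0).
move=> [A B] /and3P[/= /andP[sA /cyclicP[a Aa]] /andP[sB /cyclicP[b Bb]] cAB] maxAB.
have aG : a \in G by rewrite -cycle_subG -Aa.
have bG : b \in G by rewrite -cycle_subG -Bb.
have : chi G G c (a, b) = c (bcls G G (setX A B)) * (theta A a * theta B b).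
  rewrite /chi (bigD1 (bcls G G (setX A B))) //= big1 => [|C nC].
    have [r rG ->] := pick_cls_bcls G G (setX A B).
    by rewrite addr0 marks_conj // marks_setX.
  have [->|cC] := eqVneq (c C) 0; first by rewrite mul0r.
  have [[A' B'] /= [sA' sB' CE]] := IcG_supp cI cC.
  have [r rG pE] := pick_cls_bcls G G (setX A' B').
  rewrite CE pE marks_conj // marks_setX /=.
  apply/eqP; rewrite mulf_eq0; apply/orP; right; apply: contraR nC.
  rewrite mulf_eq0 negb_or => /andP[/marks_neq0_ex[s sG aA'] /marks_neq0_ex[t tG bB']].
  have sAA : A \subset (A' :^ s)%G by rewrite Aa cycle_subG.
  have sBB : B \subset (B' :^ t)%G by rewrite Bb cycle_subG.
  have := maxAB (A', B'); rewrite /P /= sA' sB' -CE cC => /(_ isT) le.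
  have := subset_leq_card sAA; have := subset_leq_card sBB; rewrite !cardJg => leB leA.
  have A'0 := cardG_gt0 A'; have B'0 := cardG_gt0 B'.
  have geA : (#|A'| <= #|A|)%N.
    by rewrite -(leq_pmul2r B'0) (leq_trans le) // leq_mul2l leB orbT.
  have geB : (#|B'| <= #|B|)%N.
    by rewrite -(leq_pmul2l A'0) (leq_trans le) // leq_mul2r leA orbT.
  have AE : A :=: (A' :^ s)%g by apply/eqP; rewrite eqEcard sAA cardJg.
  have BE : B :=: (B' :^ t)%g by apply/eqP; rewrite eqEcard sBB cardJg.
  by rewrite CE AE BE -(setX_conj A' B' (s, t)) bcls_conj // in_setX sG.
rewrite chi_c0 // => /esym/eqP; rewrite mulf_eq0 (negbTE cAB) orFb mulf_eq0.
have tA : theta A a != 0 by apply: (marks_neq0 (group1 G)); rewrite conjsg1 Aa cycle_id.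
have tB : theta B b != 0 by apply: (marks_neq0 (group1 G)); rewrite conjsg1 Bb cycle_id.
by rewrite (negbTE tA) (negbTE tB).
Qed.

Lemma sandwich_Vc0 c (w w' : {ffun gT -> k^o}) :
  (forall B C : {group gT}, B \subset G -> C \subset G ->
     sandwich G (theta B) (theta C) c = 0) ->
  w \in Vc -> w' \in Vc -> sandwich G w w' c = 0.
Proof.
move=> c0 wV w'V; elim/sumv_ind: w / wV => [|u v uP vP|B v /andP[sB _] /vlineP[a ->]].
- by rewrite /sandwich big1 // => g _; rewrite big1 // => h _; rewrite ffunE !mul0r.
- rewrite -[RHS]addr0 -{1}uP -vP /sandwich -big_split /=.
  apply: eq_bigr => g _; rewrite -big_split; apply: eq_bigr => h _ /=.
  by rewrite ffunE !mulrDl.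
elim/sumv_ind: w' / w'V => [|u w uP wP|C w /andP[sC _] /vlineP[b ->]].
- by rewrite /sandwich big1 // => g _; rewrite big1 // => h _; rewrite [(0 : {ffun _}) h]ffunE mulr0.
- rewrite -[RHS]addr0 -{1}uP -wP /sandwich -big_split /=.
  apply: eq_bigr => g _; rewrite -big_split; apply: eq_bigr => h _ /=.
  by rewrite [(u + w) h]ffunE !mulrDr.
rewrite -[RHS](mulr0 (a * b)) -(c0 B C sB sC) /sandwich mulr_sumr.
apply: eq_bigr => g gG; rewrite mulr_sumr; apply: eq_bigr => h hG.
by rewrite !ffunE gG hG /GRing.scale /=; ring.
Qed.

(** By Artin induction the pairing may be tested on class indicators instead of permutation
    characters. Since [chi G G c] is constant on products of classes, this returns its values up to
    the nonzero class sizes. *)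
Lemma IcG_sandwich_inj c : c \in IcG k G ->
  (forall B C : {group gT}, B \subset G -> C \subset G ->
     sandwich G (theta B) (theta C) c = 0) -> c = 0.
Proof.
move=> cI c0; apply: chi_IcG_inj => // g h gG hG.
have := sandwich_Vc0 c0 (deltaf_in_Vc gG) (deltaf_in_Vc hG).
have -> : sandwich G (deltaf g) (deltaf h) c = ncls g * (ncls h * chi G G c (g, h)).
  rewrite -(sum_deltaf (g := h) (f := fun t => chi G G c (g, t))); last first.
    by move=> t tG e; apply: chi_IcG_cyc_cls.
  pose f s := \sum_(t in G) deltaf h t * chi G G c (s, t).
  rewrite -/(f g) -(sum_deltaf (g := g) (f := f)); last first.
    move=> s sG e; apply: eq_bigr => t tG; congr (_ * _).
    exact: chi_IcG_cyc_cls.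
  apply: eq_bigr => s sG; rewrite mulr_sumr; apply: eq_bigr => t tG; ring.
by move/eqP; rewrite !mulf_eq0 !(negbTE (ncls_neq0 _)) //= => /eqP.
Qed.

End Artin.

(** * Annihilators in $S_{1,k}(G)$ and the Jacobson radical *)

Section Jacobson.
Variables (k : fieldType) (gT : finGroupType) (G : {group gT}).
Local Notation pT := (gT * gT)%type.
Local Notation Bv := (Bvec k gT).
Local Notation one := (one_grp gT).
Implicit Types (A B : {group gT}) (x u v : Bv).

Local Notation theta B := (marks k (gval G) (gval B)).

Definition sandwichl (w' : gT -> k) (u : Bv) : {ffun {group gT} -> k^o} :=
  [ffun B : {group gT} => if B \subset G then sandwich G (theta B) w' u else 0].

Lemma sandwichl_linear w' : linear (sandwichl w').
Proof.
move=> c u v; apply/ffunP=> B; rewrite !ffunE sandwich_lin.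
by case: ifP => // _; rewrite scaler0 addr0.
Qed.

HB.instance Definition _ w' :=
  GRing.isLinear.Build k Bv {ffun {group gT} -> k^o} *:%R (sandwichl w')
    (sandwichl_linear w').

(** When [w'] is the character of some [x] in kB(G,1), this is the annihilator in kB(G,G) of the
    image of [x] in $S_{1,k}(G)$. *)
Definition lann (w' : gT -> k) : {vspace Bv} :=
  (kB k G G :&: lker (linfun (sandwichl w')))%VS.

Lemma lannP w' u : reflect
  (u \in kB k G G /\ forall B, B \subset G -> sandwich G (theta B) w' u = 0)
  (u \in lann w').
Proof.
rewrite memv_cap memv_ker lfunE /=; apply: (iffP andP) => -[ukB u0]; split=> //.
  by move=> B sB; move/eqP/ffunP/(_ B): u0; rewrite !ffunE sB.
by apply/eqP/ffunP=> B; rewrite !ffunE; case: ifP => // /u0.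
Qed.

(** The ideal M as a subspace: the common annihilator of the images of the generators $e_{C,1}$ of
    $L_{1,k}(G)$. *)
Definition annV : {vspace Bv} :=
  (\bigcap_(C : {group gT} | C \subset G) lann (theta C))%VS.

Hypothesis char0 : [pchar k] =i pred0.

Lemma annVP v : v \in annV <-> annS1k G v.
Proof.
rewrite annS1kP // memvE; split=> [/subv_bigcapP vP | [vkB vP]].
  split=> [|B C sB sC].
    by have := vP [1 gT]%G (sub1G G); rewrite -memvE => /lannP[].
  by have := vP C sC; rewrite -memvE => /lannP[_]; apply.
by apply/subv_bigcapP => C sC; rewrite -memvE; apply/lannP; split=> // B sB; apply: vP.
Qed.

Lemma sandwich_bmul (w w' : gT -> k) v u : v \in kB k G G -> u \in kB k G G ->
  sandwich G w w' (bmul G G G v u) =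
  #|G|%:R^-1 * \sum_(t in G) \sum_(h in G)
     (\sum_(g in G) w g * chi G G v (g, t)) * chi G G u (t, h) * w' h.
Proof.
move=> vkB ukB; rewrite /sandwich mulr_sumr.
transitivity (\sum_(g in G) \sum_(t in G) \sum_(h in G)
   #|G|%:R^-1 * (w g * chi G G v (g, t) * chi G G u (t, h) * w' h)).
  apply: eq_bigr => g _; rewrite [RHS]exchange_big; apply: eq_bigr => h _ /=.
  rewrite chi_bmul // !mulr_sumr mulr_suml.
  by apply: eq_bigr => t _; ring.
rewrite exchange_big; apply: eq_bigr => t _ /=; rewrite exchange_big mulr_sumr.
apply: eq_bigr => h _ /=; rewrite !mulr_suml mulr_sumr.
by apply: eq_bigr => g _.
Qed.

Lemma sum_theta_chi B v t : B \subset G -> v \in kB k G G ->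
  \sum_(g in G) theta B g * chi G G v (g, t)
  = #|G|%:R * chi one G (bmul one G G (eB k one G (setX one B)) v) (1%g, t).
Proof.
move=> sB vkB; rewrite chi_bmul ?mem_eB1G // mulVKf ?natr_card_neq0 //.
by apply: eq_bigr => g _; rewrite chi_eB1G.
Qed.

(** Moving [v] to the left factor replaces $\theta_B$ by $|G|$ times the character of $e_{1,B}\,v$
    in kB(1,G), and vanishing against every $\theta_B$ extends linearly to all of kB(1,G). *)
Lemma left_ideal_lann w' : left_ideal G (lann w').
Proof.
split=> [|v u vkB /lannP[ukB u0]]; first exact: capvSl.
apply/lannP; split=> [|B sB]; first exact: (bmul_kB char0 (Y := G)).
have bkB := bmul_kB char0 (mem_eB1G k sB) vkB.
rewrite sandwich_bmul //; apply/eqP; rewrite mulf_eq0; apply/orP; right; apply/eqP.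
transitivity (#|G|%:R * sandwich G (fun t =>
    chi one G (bmul one G G (eB k one G (setX one B)) v) (1%g, t)) w' u).
  rewrite mulr_sumr; apply: eq_bigr => t _; rewrite mulr_sumr; apply: eq_bigr => h _.
  by rewrite sum_theta_chi //; ring.
by rewrite chi0_sandwich ?mulr0.
Qed.

(* If [u'] is not in the annihilator of [x], some [psi] pairs [u' x] to a
   nonzero scalar [s], and then [v x] and [s^-1 ((v x) psi) u' x] agree in S_{1,k}(G). *)
Lemma max_left_ideal_lann x a : x \in kB k G one -> a \in kB k G G ->
  a \notin lann (fun h => chi G one x (h, 1%g)) ->
  max_left_ideal G (lann (fun h => chi G one x (h, 1%g))).
Proof.
set w' := fun h => _; move=> xkB akB aU; split; first exact: left_ideal_lann.
split=> [|U' [sU' idU'] sUU']; first by apply: contraNneq aU => ->.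
have [sU'U|/subvPn[u' u'U' u'U]] := boolP (U' <= lann w')%VS.
  by left; apply/eqP; rewrite eqEsubv sU'U.
right; apply/eqP; rewrite eqEsubv sU' /=; apply/subvP=> v vkB.
have u'kB := subvP sU' _ u'U'.
have [B sB s0] : exists2 B : {group gT}, B \subset G & sandwich G (theta B) w' u' != 0.
  have [/existsP[B /andP[sB s0]]|/existsPn no] :=
    boolP [exists B : {group gT}, (B \subset G) && (sandwich G (theta B) w' u' != 0)].
    by exists B.
  case/negP: u'U; apply/lannP; split=> // B sB; apply/eqP.
  by have := no B; rewrite sB /= negbK.
set s := sandwich _ _ _ _ in s0.
pose y := bmul G G one v x; pose m := bmul G one G y (eB k one G (setX one B)).
have ykB : y \in kB k G one by apply: (bmul_kB char0 (Y := G)).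
have mkB : m \in kB k G G by apply: (bmul_kB char0 (Y := one)) => //; apply: mem_eB1G.
have chim g t : chi G G m (g, t) = chi G one y (g, 1%g) * theta B t.
  by rewrite chi_bmul ?mem_eB1G // cards1 invr1 mul1r big_set1 chi_eB1G.
(* One factor $|G|$ undoes the normalisation of the convolution in [m u'], the other that in [v x];
   the product over the trivial group that forms [m] has normalisation 1. *)
pose c := #|G|%:R ^+ 2 / s.
have muU' : bmul G G G m u' \in U' by apply: idU'.
rewrite -[v](subrK (c *: bmul G G G m u')) memvD ?memvZ //.
apply: (subvP sUU'); apply/lannP; split=> [|E sE].
  by rewrite memvB ?memvZ // (bmul_kB char0 (Y := G)).
rewrite addrC -scaleNr sandwich_lin.
have := sum_chi_bmul char0 (theta E) vkB xkB; rewrite -/y -/w' => /esym/(canRL (mulKf _)) ->.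
  rewrite invrK sandwich_bmul //.
  have -> : \sum_(t in G) \sum_(h in G) (\sum_(g in G) theta E g * chi G G m (g, t))
       * chi G G u' (t, h) * w' h = (\sum_(g in G) theta E g * chi G one y (g, 1%g)) * s.
    rewrite /s /sandwich mulr_sumr; apply: eq_bigr => t _; rewrite mulr_sumr.
    apply: eq_bigr => h _.
    have -> : \sum_(g in G) theta E g * chi G G m (g, t)
        = (\sum_(g in G) theta E g * chi G one y (g, 1%g)) * theta B t.
      by rewrite mulr_suml; apply: eq_bigr => g _; rewrite chim mulrA.
    ring.
  by rewrite /c; field; rewrite s0 natr_card_neq0.
by rewrite invr_eq0 natr_card_neq0.
Qed.

Lemma jacobson_annS1k v : jacobson G v -> annS1k G v.
Proof.
move=> [vkB vJ]; apply/annVP; rewrite memvE; apply/subv_bigcapP => C sC.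
rewrite -memvE; have xkB := mem_eBG1 k sC.
have -> : lann (theta C) = lann (fun h => chi G one (eB k G one (setX C one)) (h, 1%g)).
  apply/vspaceP=> u; apply/lannP/lannP => -[ukB u0]; split=> // B sB;
    rewrite -[RHS](u0 B sB); apply: eq_bigr => g _; apply: eq_bigr => h _;
    by rewrite chi_eBG1.
(* If [v] were outside the annihilator, the annihilator would be proper, hence maximal, hence would
   contain the radical element [v]. *)
by apply/negPn/negP => vU; case/negP: (vU); apply/vJ/(max_left_ideal_lann xkB vkB vU).
Qed.

Lemma bmul_IG_ann_IG x n y : x \in IG k G -> y \in IG k G -> n \in IG k G ->
  annS1k G n -> bmul G G G x (bmul G G G n y) = 0.
Proof.
move=> xI yI nI /(annS1kP char0)[_ n0].
elim/IG_ind: x / xI => [|c u v uP vP|A B sA sB]; first by rewrite bmul0l.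
  by rewrite bmul_linl uP vP scaler0 addr0.
elim/IG_ind: y / yI => [|c u v uP vP|C D sC sD]; first by rewrite !bmul0r.
  by rewrite !bmul_linr uP vP scaler0 addr0.
by rewrite bmul_eB_IG_eB // n0 // mulr0 scale0r.
Qed.

Lemma left_ideal_annV : left_ideal G annV.
Proof.
split=> [|x u xkB]; first by apply/subvP=> v /annVP[].
rewrite !memvE => /subv_bigcapP uP; apply/subv_bigcapP => C sC.
have := uP C sC; rewrite -!memvE; exact: (left_ideal_lann _).2.
Qed.

(* A maximal left ideal [U] not containing the nilpotent left ideal
   [N = IG :&: annV] would satisfy [1 = u + n] with [n (n n) = 0]. *)
Lemma IG_annV_jacobson v : v \in IG k G -> v \in annV -> jacobson G v.
Proof.
move=> vI vM; split=> [|U [[sU idU] [UkB maxU]]]; first exact: (subvP (IG_sub_kB k G)).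
apply/negPn/negP => vU; case/negP: UkB; apply/eqP.
pose N := (IG k G :&: annV)%VS.
have idUN : left_ideal G (U + N)%VS.
  split; first by rewrite subv_add sU (subv_trans (capvSl _ _)) ?IG_sub_kB.
  move=> x z xkB /memv_addP[u uU [n]]; rewrite memv_cap => /andP[nI nM] ->.
  rewrite -[u]scale1r bmul_linr scale1r memv_add ?idU // memv_cap bmul_IG //=.
  exact: left_ideal_annV.2.
have [UN|UN] := maxU _ idUN (addvSl _ _).
  by case/negP: vU; rewrite -UN (subvP (addvSr _ _)) // memv_cap vI.
have : eB k G G (diag G) \in (U + N)%VS by rewrite UN mem_kB // diag_sub.
case/memv_addP=> u uU [n]; rewrite memv_cap => /andP[nI /annVP nM] oneE.
have nkB := subvP (IG_sub_kB k G) _ nI.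
have mul1 x : x \in kB k G G -> x = bmul G G G x u + bmul G G G x n.
  by move=> xkB; rewrite -{1}(bmul_idr char0 xkB) oneE -[u]scale1r bmul_linr !scale1r.
(* Three uses of the decomposed identity: [n n = n (n u) + n (n n)] lies in [U], then so does
   [n = n u + n n], then so does every [x = x u + x n]. *)
have nnU : bmul G G G n n \in U.
  rewrite {2}(mul1 n nkB) -[X in X + _]scale1r bmul_linr scale1r (bmul_IG_ann_IG nI nI nI nM) addr0.
  by rewrite !idU.
have nU : n \in U by rewrite (mul1 n nkB) memvD // idU.
apply/eqP; rewrite eqEsubv sU; apply/subvP=> x xkB.
by rewrite (mul1 x xkB) memvD ?idU.
Qed.

End Jacobson.

(** * Dimensions of $I(G)$ and $I_c(G)$ *)

Section Dimensions.
Variables (k : fieldType) (gT : finGroupType) (G : {group gT}).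
Local Notation Bv := (Bvec k gT).

Definition delta_cls (C : cls_index gT) : Bv := [ffun D => (D == C)%:R].

Lemma dim_sum_delta (S : {set cls_index gT}) :
  \dim (\sum_(C in S) <[delta_cls C]>)%VS = #|S|.
Proof.
have -> : (\sum_(C in S) <[delta_cls C]>)%VS = <<[seq delta_cls C | C <- enum S]>>%VS.
  by rewrite span_def big_map big_enum.
rewrite cardE -(size_map delta_cls).
apply/eqP; rewrite -/(free _) -[X in free X]in_tupleE; apply/freeP => c c0 i.
have iS : (i < size (enum S))%N by rewrite -(size_map delta_cls).
pose C := nth set0 (enum S) i.
move/ffunP/(_ C): c0; rewrite sum_ffunE ffunE (bigD1 i) //= big1 ?addr0.
  by rewrite !ffunE (nth_map set0) // ffunE eqxx /GRing.scale /= mulr1.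
move=> j ji; have jS : (j < size (enum S))%N by rewrite -(size_map delta_cls).
rewrite !ffunE (nth_map set0) // ffunE /C nth_uniq ?enum_uniq //.
by rewrite eq_sym (inj_eq val_inj) (negbTE ji) scaler0.
Qed.

Definition prod_cls (PQ : {set {set gT}} * {set {set gT}}) : cls_index gT :=
  [set setX P Q | P in PQ.1, Q in PQ.2].

Lemma bcls_setX (A B : {group gT}) :
  bcls G G (setX A B) = prod_cls ((A :^: G)%g, (B :^: G)%g).
Proof.
apply/setP=> L; apply/imsetP/imset2P.
  case=> -[r s]; rewrite in_setX => /andP[rG sG] ->.
  by exists (A :^ r)%g (B :^ s)%g; rewrite ?imset_f // setX_conj.
case=> _ _ /imsetP[r rG ->] /imsetP[s sG ->] ->.
by exists (r, s); rewrite ?in_setX ?rG // setX_conj.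
Qed.

Definition sub_cls (P : pred {group gT}) : {set {set {set gT}}} :=
  [set (H :^: G)%g | H : {group gT} in [set H : {group gT} | P H]].

Lemma prod_cls_inj (P : pred {group gT}) :
  {in setX (sub_cls P) (sub_cls P) &, injective prod_cls}.
Proof.
have sub (A A' B B' : {group gT}) :
    prod_cls ((A :^: G)%g, (B :^: G)%g) = prod_cls ((A' :^: G)%g, (B' :^: G)%g) ->
    (A :^: G = A' :^: G)%g /\ (B :^: G = B' :^: G)%g.
  rewrite -!bcls_setX => e.
  have : setX A B \in bcls G G (setX A' B').
    by rewrite -e; apply/imsetP; exists 1%g; rewrite ?group1 ?conjsg1.
  case/imsetP=> -[r s]; rewrite in_setX => /andP[rG sG]; rewrite setX_conj /= => eX.
  (* Slicing a product subgroup at the identity of one factor recovers the other factor. *)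
  have -> : A :=: (A' :^ r)%g.
    apply/setP=> g; move/setP/(_ (g, 1%g)): eX.
    by rewrite !in_setX group1 (group1 (B' :^ s)%G) !andbT.
  have -> : B :=: (B' :^ s)%g.
    apply/setP=> g; move/setP/(_ (1%g, g)): eX.
    by rewrite !in_setX group1 (group1 (A' :^ r)%G).
  by rewrite !conjugates_conj !lcoset_id.
move=> [a b] [a' b']; rewrite !in_setX.
case/andP=> /imsetP[A _ ->] /imsetP[B _ ->] /andP[/imsetP[A' _ ->] /imsetP[B' _ ->]].
by move/sub=> [-> ->].
Qed.

(** The class of [setX A B] is the product of the classes of [A] and [B] and determines both, so the
    generators, listed with repetitions, are distinct coordinate vectors indexed by pairs of
    classes. *)
Lemma dim_sum_eB (P : pred {group gT}) :
  \dim (\sum_(A : {group gT} | P A) \sum_(B : {group gT} | P B)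
     <[eB k G G (setX A B)]>)%VS = (#|sub_cls P| ^ 2)%N.
Proof.
rewrite -mulnn -cardsX -(card_in_imset (@prod_cls_inj P)) -dim_sum_delta.
congr (\dim _); apply/eqP; rewrite eqEsubv; apply/andP; split.
  apply/subv_sumP => A PA; apply/subv_sumP => B PB.
  apply: (sumv_sup (bcls G G (setX A B))); last exact: subvv.
  rewrite bcls_setX; apply: imset_f; rewrite in_setX.
  by apply/andP; split; apply: imset_f; rewrite inE.
apply/subv_sumP => C /imsetP[[a b]].
rewrite in_setX => /andP[/imsetP[A + ->] /imsetP[B + ->]] ->.
rewrite !inE => PA PB; apply: (sumv_sup A) => //; apply: (sumv_sup B) => //.
by rewrite /eB bcls_setX.
Qed.

Lemma dim_IG : \dim (IG k G) = (nb_cls_sub G ^ 2)%N.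
Proof.
by rewrite [LHS](dim_sum_eB (fun A => A \subset G)).
Qed.

Lemma dim_IcG : \dim (IcG k G) = (nb_cls_cyc G ^ 2)%N.
Proof.
rewrite [LHS](dim_sum_eB (fun A => (A \subset G) && cyclic A)) /nb_cls_cyc.
suff -> : [set H in subgroups G | cyclic H] =
    [set H : {group gT} | (H \subset G) && cyclic H] by [].
by apply/setP=> H; rewrite !inE.
Qed.

End Dimensions.

(** * The two decompositions and the dimension formula *)

Theorem theorem10p2 (k : fieldType) (gT : finGroupType) (G : {group gT}) :
  [pchar k] =i pred0 ->
  [/\ direct_sum (fun v => v \in kB k G G) (fun v => v \in IcG k G) (annS1k (k:=k) G),
      direct_sum (fun v => v \in IG k G) (fun v => v \in IcG k G)
                 (fun v => v \in IG k G /\ jacobson (k:=k) G v)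
    & exists U : {vspace Bvec k gT},
        (forall v, v \in U <-> (v \in IG k G /\ jacobson (k:=k) G v)) /\
        \dim U = (nb_cls_sub G ^ 2 - nb_cls_cyc G ^ 2)%N].
Proof.
move=> char0.
(* Inside I(G) the radical coincides with M, so the second decomposition is the first one
   intersected with I(G), which contains $I_c(G)$. *)
have jacP v : v \in IG k G -> jacobson G v <-> v \in annV k G.
  move=> vI; split=> [/(jacobson_annS1k char0)/(annVP _ char0) //|].
  exact: IG_annV_jacobson.
have approx v : v \in kB k G G -> exists2 c, c \in IcG k G & v - c \in annV k G.
  move=> vkB; have [c cI cP] := IcG_approx G char0 v; exists c => //.
  apply/annVP/annS1kP => //; split.
    by rewrite memvB // (subvP (IG_sub_kB k G)) // (subvP (IcG_sub_IG k G)).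
  by move=> B C sB sC; rewrite addrC -scaleN1r sandwich_lin cP mulN1r addNr.
have inj0 v : v \in IcG k G -> v \in annV k G -> v = 0.
  by move=> vI /(annVP _ char0)/(annS1kP char0)[_]; apply: IcG_sandwich_inj.
have IcI := subvP (IcG_sub_IG k G); have IkB := subvP (IG_sub_kB k G).
split.
- split=> [v|v vI /(annVP _ char0)]; last exact: inj0.
  split=> [/approx[c cI vcM] | [p [q [pI [[qkB _] ->]]]]].
    exists c, (v - c); split=> //; split; last by rewrite addrC subrK.
    exact/annVP.
  by rewrite memvD // IkB // IcI.
- split=> [v|v vI [vIG /(jacP v vIG)]]; last exact: inj0.
  split=> [vI | [p [q [pI [[qI _] ->]]]]]; last by rewrite memvD // IcI.
  have [c cI vcM] := approx v (IkB v vI).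
  have vcI : v - c \in IG k G by rewrite memvB // IcI.
  exists c, (v - c); split=> //; split; last by rewrite addrC subrK.
  by split=> //; apply/jacP.
exists (IG k G :&: annV k G)%VS; split=> [v|].
  rewrite memv_cap; split=> [/andP[vI vM] | [vI /(jacP v vI) vM]]; last by rewrite vI.
  by split=> //; apply/jacP.
(* The dimension formula is additivity of dimension along this direct decomposition of I(G). *)
have IGE : (IcG k G + (IG k G :&: annV k G))%VS = IG k G.
  apply/eqP; rewrite eqEsubv subv_add IcG_sub_IG capvSl /=.
  apply/subvP=> v vI; have [c cI vcM] := approx v (IkB v vI).
  rewrite -[v](subrK c) addrC memv_add // memv_cap vcM andbT memvB //; exact: IcI.
rewrite -(dim_IG k) -(dim_IcG k) -[in X in (X - _)%N]IGE dimv_disjoint_sum ?addKn //.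
apply/eqP; rewrite -subv0; apply/subvP=> v; rewrite !memv_cap memv0.
by case/and3P=> vI _ vM; rewrite (inj0 v vI vM).
Qed.
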